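(* Let $M$ be a matroid. The algebra $S(M)$ is isomorphic to the subalgebra of $\mathrm{End}(\widetilde{\mathcal B})$ generated by the elements $\tilde\mu_{\check u}$ and $\tilde\kappa_{\check u}$ for all $\check u\in\widetilde{\mathcal U}$.
   Context: $M$ is a matroid on a finite ground set $E$ with lattice of flats $\mathcal L$ ordered by inclusion and rank function $\rho$. For flats write $K\lessdot L$ (or $L\gtrdot K$) if $L$ covers $K$. A flag path is a finite nonempty sequence $(K_1,\dots,K_l)$ of flats with $K_i\lessdot K_{i+1}$ or $K_i\gtrdot K_{i+1}$ for each $i<l$. The free $\mathbb Z$-module on flag paths is an algebra under concatenation: $(K_1,\dots,K_l)\cdot(L_1,\dots,L_{l'})=(K_1,\dots,K_l=L_1,L_2,\dots,L_{l'})$ if $K_l=L_1$ and $0$ otherwise. $S(M)$ is its quotient by the two-sided ideal generated by: (FS) for flats $L<K$ with $\rho(K)=\rho(L)+2$: $\sum_X(L\lessdot X\lessdot K)=0=\sum_X(K\gtrdot X\gtrdot L)$, sums over flats $X$ with $K\gtrdot X\gtrdot L$; ($\bigwedge$) for $K\lessdot L$ and $K'\lessdot L$: $(K\lessdot L\gtrdot K')$ equals $|L\setminus K|\,(K)$ if $K=K'$; $-(K\gtrdot K\cap K'\lessdot K')$ if $K\ne K'$ and $K\cap K'\lessdot K$; and $0$ otherwise. Fix a total order on $E$. In the exterior algebra over $\mathbb Z$ on generators $E$, for $S=\{s_1<\dots<s_p\}\subseteq E$ put $e_S=s_1\wedge\dots\wedge s_p$. For flats $F\subseteq G$, $M^G_F$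 is the restriction of $M$ to $G$ contracted by $F$ (a matroid on $G\setminus F$ whose bases are the $B\subseteq G\setminus F$ with $|B|=\rho(G)-\rho(F)$ and $G$ the closure of $F\cup B$); $\mathcal B^G_F$ is the free $\mathbb Z$-module spanned by $e_B$ for bases $B$ of $M^G_F$, and $\mathcal B^G_F=0$ if $F\not\subseteq G$. $\widetilde{\mathcal B}=\bigoplus_{F,G\in\mathcal L}\mathcal B^G_F$ (external direct sum), with the symmetric form for which the summands are orthogonal and the monomials $e_B$ in each summand orthonormal. For flats $F\subseteq G\subseteq H$ the wedge product gives $\ast:\mathcal B^H_G\otimes\mathcal B^G_F\to\mathcal B^H_F$; extend to $\widetilde{\mathcal B}$ by letting $\mathcal B^H_G\ast\mathcal B^{G'}_F=0$ for $G\ne G'$. For $b\in\widetilde{\mathcal B}$, $\tilde\mu_b\in\mathrm{End}(\widetilde{\mathcal B})$ is $\tilde\mu_b(x)=b\ast x$, and $\tilde\kappa_b$ is the adjoint of $\tilde\mu_b$. For flats $F\subseteq G$, $\check{\mathcal U}^G_F=\{x\in\mathcal B^G_F:\ (\sum_{s\in G\setminus F}s)\wedge x=0\}$, and $\widetilde{\mathcal U}=\bigoplus_{F\subseteq G,\ F,G\in\mathcal L}\check{\mathcal U}^G_F\subseteq\widetilde{\mathcal B}$. *)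

(* Defs.v *)
From HB Require Import structures.
From mathcomp Require Import all_boot all_order all_algebra.
From mathcomp Require Import boolp.
From mathcomp Require Import freeg ring.

Set Implicit Arguments.
Unset Strict Implicit.
Unset Printing Implicit Defensive.

Import Order.TTheory GRing.Theory Num.Theory.

Local Open Scope ring_scope.

Section Generated.
Variables (R : pzRingType) (G : R -> Prop).

Inductive in_ideal : R -> Prop :=
| in_ideal_gen x : G x -> in_ideal x
| in_ideal0 : in_ideal 0
| in_idealB x y : in_ideal x -> in_ideal y -> in_ideal (x - y)
| in_idealMl a x : in_ideal x -> in_ideal (a * x)
| in_idealMr a x : in_ideal x -> in_ideal (x * a).

Definition ideal_gen : {pred R} := fun x => `[< in_ideal x >].

Lemma ideal_genP x : reflect (in_ideal x) (x \in ideal_gen).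
Proof. exact: asboolP. Qed.

Fact ideal_gen_zmod_closed : zmod_closed ideal_gen.
Proof.
split=> [|x y /ideal_genP Ix /ideal_genP Iy]; apply/ideal_genP.
  exact: in_ideal0.
exact: in_idealB.
Qed.

HB.instance Definition _ :=
  GRing.isZmodClosed.Build R ideal_gen ideal_gen_zmod_closed.

Definition quot_ring := Quotient.quot ideal_gen.

HB.instance Definition _ := GRing.Zmodule.on quot_ring.

Definition qpi (x : R) : quot_ring := (\pi_quot_ring x)%qT.
Definition qrepr (x : quot_ring) : R := generic_quotient.repr x.

Lemma qreprK x : qpi (qrepr x) = x.
Proof. exact: generic_quotient.reprK. Qed.

Lemma qpi_eq x y : (qpi x = qpi y) <-> in_ideal (x - y).
Proof.
by split=> [/eqP|/ideal_genP Ixy]; [|apply/eqP];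
  rewrite /qpi -Quotient.idealrBE // => /ideal_genP.
Qed.

Fact qpi_is_additive : zmod_morphism qpi.
Proof. by move=> x y; rewrite /qpi !generic_quotient.piE. Qed.

HB.instance Definition _ :=
  GRing.isZmodMorphism.Build R quot_ring qpi qpi_is_additive.

Definition qmul (x y : quot_ring) := qpi (qrepr x * qrepr y).

Lemma qpiM x y : qmul (qpi x) (qpi y) = qpi (x * y).
Proof.
apply/qpi_eq; set x' := qrepr _; set y' := qrepr _.
have Ix : in_ideal (x' - x) by apply/qpi_eq; exact: qreprK.
have Iy : in_ideal (y' - y) by apply/qpi_eq; exact: qreprK.
have -> : x' * y' - x * y = (x' - x) * y' - x * (y - y').
  by rewrite mulrBl mulrBr opprB addrA subrK.
apply: in_idealB; first exact: in_idealMr.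
apply: in_idealMl; rewrite -(opprB y') -sub0r.
by apply: in_idealB => //; apply: in_ideal0.
Qed.

Fact qmulA : associative qmul.
Proof.
by move=> x y z; rewrite -(qreprK x) -(qreprK y) -(qreprK z) !qpiM mulrA.
Qed.
Fact qmul1l : left_id (qpi 1) qmul.
Proof. by move=> x; rewrite -(qreprK x) qpiM mul1r. Qed.
Fact qmul1r : right_id (qpi 1) qmul.
Proof. by move=> x; rewrite -(qreprK x) qpiM mulr1. Qed.
Fact qmulDl : left_distributive qmul +%R.
Proof.
move=> x y z; rewrite -(qreprK x) -(qreprK y) -(qreprK z).
by rewrite -raddfD !qpiM -raddfD mulrDl.
Qed.
Fact qmulDr : right_distributive qmul +%R.
Proof.
move=> x y z; rewrite -(qreprK x) -(qreprK y) -(qreprK z).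
by rewrite -raddfD !qpiM -raddfD mulrDr.
Qed.

HB.instance Definition _ := GRing.Zmodule_isPzRing.Build quot_ring
  qmulA qmul1l qmul1r qmulDl qmulDr.

Inductive in_subring : R -> Prop :=
| in_subring_gen x : G x -> in_subring x
| in_subring1 : in_subring 1
| in_subringB x y : in_subring x -> in_subring y -> in_subring (x - y)
| in_subringM x y : in_subring x -> in_subring y -> in_subring (x * y).

Definition subring_gen : {pred R} := fun x => `[< in_subring x >].

Lemma subring_genP x : reflect (in_subring x) (x \in subring_gen).
Proof. exact: asboolP. Qed.

Fact subring_gen_closed : subring_closed subring_gen.
Proof.
split=> [|x y /subring_genP Sx /subring_genP Sy|
          x y /subring_genP Sx /subring_genP Sy]; apply/subring_genP.
- exact: in_subring1.
- exact: in_subringB.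
- exact: in_subringM.
Qed.

Record subring := Subring {
  subring_val :> R;
  subring_valP : subring_val \in subring_gen }.

HB.instance Definition _ := [isSub for subring_val].
HB.instance Definition _ := [Choice of subring by <:].
HB.instance Definition _ :=
  GRing.SubChoice_isSubPzRing.Build R subring_gen subring subring_gen_closed.

End Generated.

Section EndomorphismRing.
Variable V : zmodType.

(* The ring End(V) of Z-linear, i.e. additive, endomorphisms; the product is
   composition. *)
Record endz := Endz {
  endz_fun :> V -> V;
  endz_additive : zmod_morphism endz_fun }.

HB.instance Definition _ (f : endz) :=
  GRing.isZmodMorphism.Build V V f (endz_additive f).

HB.instance Definition _ := gen_eqMixin endz.
HB.instance Definition _ := gen_choiceMixin endz.

Lemma endzP (f g : endz) : f =1 g -> f = g.
Proof.
case: f g => [f Hf] [g Hg] /= /funext eq_fg; rewrite eq_fg in Hf *.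
by congr Endz; exact: Prop_irrelevance.
Qed.

Fact endz0_subproof : zmod_morphism (fun _ : V => 0 : V).
Proof. by move=> x y; rewrite subr0. Qed.
Fact endz1_subproof : zmod_morphism (fun x : V => x).
Proof. by []. Qed.
Fact endzN_subproof (f : endz) : zmod_morphism (fun x => - f x).
Proof. by move=> x y; rewrite raddfB opprD. Qed.
Fact endzD_subproof (f g : endz) : zmod_morphism (fun x => f x + g x).
Proof. by move=> x y; rewrite !raddfB opprD addrACA. Qed.
Fact endzM_subproof (f g : endz) : zmod_morphism (fun x => f (g x)).
Proof. by move=> x y; rewrite !raddfB. Qed.

Definition endz0 := Endz endz0_subproof.
Definition endz1 := Endz endz1_subproof.
Definition endzN f := Endz (endzN_subproof f).
Definition endzD f g := Endz (endzD_subproof f g).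
Definition endzM f g := Endz (endzM_subproof f g).

Fact endzDA : associative endzD.
Proof. by move=> f g h; apply: endzP => x /=; rewrite addrA. Qed.
Fact endzDC : commutative endzD.
Proof. by move=> f g; apply: endzP => x /=; rewrite addrC. Qed.
Fact endzD0 : left_id endz0 endzD.
Proof. by move=> f; apply: endzP => x /=; rewrite add0r. Qed.
Fact endzDN : left_inverse endz0 endzN endzD.
Proof. by move=> f; apply: endzP => x /=; rewrite addNr. Qed.

HB.instance Definition _ :=
  GRing.isZmodule.Build endz endzDA endzDC endzD0 endzDN.

Fact endzMA : associative endzM. Proof. by move=> f g h; apply: endzP. Qed.
Fact endzM1l : left_id endz1 endzM. Proof. by move=> f; apply: endzP. Qed.
Fact endzM1r : right_id endz1 endzM. Proof. by move=> f; apply: endzP. Qed.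
Fact endzMDl : left_distributive endzM +%R.
Proof. by move=> f g h; apply: endzP. Qed.
Fact endzMDr : right_distributive endzM +%R.
Proof. by move=> f g h; apply: endzP => x /=; rewrite raddfD. Qed.

HB.instance Definition _ := GRing.Zmodule_isPzRing.Build endz
  endzMA endzM1l endzM1r endzMDl endzMDr.

End EndomorphismRing.

Record matroid (E : finType) := Matroid {
  rk : {set E} -> nat;
  rk_le_card : forall A, (rk A <= #|A|)%N;
  rk_mono : forall A B : {set E}, A \subset B -> (rk A <= rk B)%N;
  rk_submod : forall A B, (rk (A :|: B) + rk (A :&: B) <= rk A + rk B)%N }.

Section Matroid.
Variables (E : finType) (M : matroid E).
Implicit Types A B F G H : {set E}.

Definition closure A : {set E} := [set x | rk M (x |: A) == rk M A].

Definition is_flat F := closure F == F.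

Lemma sub_closure A : A \subset closure A.
Proof. by apply/subsetP=> x xA; rewrite inE (setUidPr _) // sub1set. Qed.

Lemma rk_submodU A B C : A \subset B -> (rk M (C :|: B) + rk M A <=
  rk M (C :|: A) + rk M B)%N.
Proof.
move=> sAB; apply: leq_trans (rk_submod M (C :|: A) B).
rewrite -setUA (setUidPr sAB) leq_add2l rk_mono //.
by rewrite subsetI sAB subsetUr.
Qed.

Lemma rkU_closure A B : B \subset closure A -> rk M (B :|: A) = rk M A.
Proof.
elim: {B}_.+1 {-2}B (ltnSn #|B|) => // n IH B leBn sBA.
have [->|[x xB]] := set_0Vmem B; first by rewrite set0U.
have IHx : rk M ((B :\ x) :|: A) = rk M A.
  apply: IH; last exact: subset_trans (subD1set _ _) sBA.
  by rewrite -ltnS (leq_trans _ leBn) // [in ltnRHS](cardsD1 x) xB.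
apply/eqP; rewrite eqn_leq [X in _ && X]rk_mono ?subsetUr // andbT.
have := @rk_submodU A ((B :\ x) :|: A) [set x] (subsetUr _ _).
rewrite setUA setD1K // IHx leq_add2r.
by have := subsetP sBA x xB; rewrite inE => /eqP->.
Qed.

Lemma rk_closure A : rk M (closure A) = rk M A.
Proof. by rewrite -(@rkU_closure A (closure A)) // (setUidPl (sub_closure A)). Qed.

Lemma closureS A B : A \subset B -> closure A \subset closure B.
Proof.
move=> sAB; apply/subsetP => x; rewrite !inE => /eqP xA.
have := rk_submodU [set x] sAB; rewrite xA addnC leq_add2l => leB.
by rewrite eqn_leq leB rk_mono ?subsetUr.
Qed.

Lemma closure_id A : closure (closure A) = closure A.
Proof.
apply/eqP; rewrite eqEsubset sub_closure andbT.
apply/subsetP=> x; rewrite !inE rk_closure => /eqP xcA.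
rewrite eqn_leq [X in _ && X]rk_mono ?subsetUr // andbT -[leqRHS]xcA.
by rewrite rk_mono // setUS // sub_closure.
Qed.

Lemma closureU A B : closure (closure A :|: B) = closure (A :|: B).
Proof.
apply/eqP; rewrite eqEsubset; apply/andP; split; last first.
  by rewrite closureS // setSU // sub_closure.
rewrite -(closure_id (A :|: B)) closureS // subUset closureS ?subsetUl //.
by rewrite (subset_trans (subsetUr A B)) // sub_closure.
Qed.

(* [B] is a basis of the minor M^G_F, the restriction of M to G contracted by
   F. *)
Definition minor_basis F G B :=
  [&& F \subset G, B \subset G :\: F, #|B| == (rk M G - rk M F)%N
    & closure (F :|: B) == G].

Lemma minor_basis_disjoint F G H A B :
  minor_basis F G A -> minor_basis G H B -> [disjoint B & A].
Proof.
case/and4P=> _ sAG _ _ /and4P[_ sBH _ _].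
rewrite disjoint_sym disjoints_subset (subset_trans sAG) //.
apply/subsetP=> x; rewrite !inE => /andP[_ xG].
by apply: contraL xG => /(subsetP sBH); rewrite inE => /andP[].
Qed.

Lemma minor_basisU F G H A B :
  minor_basis F G A -> minor_basis G H B -> minor_basis F H (B :|: A).
Proof.
move=> bA bB; have dBA := minor_basis_disjoint bA bB.
case/and4P: bA bB => sFG sAG /eqP cA /eqP clA /and4P[sGH sBH /eqP cB /eqP clB].
apply/and4P; split; first exact: subset_trans sGH.
- rewrite subUset (subset_trans sAG) ?setSD // (subset_trans sBH) //.
  by rewrite setDS.
- rewrite cardsU disjoint_setI0 // cards0 subn0 cA cB addnC.
  by rewrite addnBAC ?rk_mono // subnKC // rk_mono.
- by rewrite [B :|: A]setUC setUA -closureU clA clB.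
Qed.

Lemma is_flatI F G : is_flat F -> is_flat G -> is_flat (F :&: G).
Proof.
move=> /eqP fF /eqP fG; rewrite /is_flat eqEsubset sub_closure andbT.
by rewrite subsetI -{2}fF -{3}fG !closureS ?subsetIl ?subsetIr.
Qed.

Definition flat := {F : {set E} | is_flat F}.

Implicit Types K L X : flat.

Definition flatI K L : flat :=
  exist _ (val K :&: val L) (is_flatI (valP K) (valP L)).

Definition covers K L :=
  (val K \proper val L) &&
  [forall X : flat, ~~ ((val K \proper val X) && (val X \proper val L))].

Lemma is_flat_closure A : is_flat (closure A).
Proof. by rewrite /is_flat closure_id. Qed.

Lemma rk_lt K L : val K \proper val L -> (rk M (val K) < rk M (val L))%N.
Proof.
case/properP=> sKL [x xL xNK]; rewrite ltn_neqAle rk_mono // andbT.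
apply: contra xNK => /eqP eqr; rewrite -(eqP (valP K)) inE eqn_leq.
rewrite [X in _ && X]rk_mono ?subsetUr // andbT eqr rk_mono //.
by rewrite subUset sub1set xL.
Qed.

Lemma coversE K L :
  covers K L = (val K \proper val L) && (rk M (val L) == (rk M (val K)).+1).
Proof.
rewrite /covers; case pKL: (val K \proper val L) => //=.
apply/forallP/eqP => [noX|rL X]; last first.
  apply/negP => /andP[/rk_lt KX /rk_lt]; rewrite rL ltnS => XK.
  by rewrite ltnNge XK in KX.
have [sKL [x xL xNK]] := properP pKL.
pose X : flat := Sub (closure (x |: val K)) (is_flat_closure _).
have KX : val K \proper val X.
  apply/properP; split; first by rewrite (subset_trans (subsetUr [set x] _)) ?sub_closure.
  by exists x; rewrite ?(subsetP (sub_closure _)) ?setU11.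
have XL : val X \subset val L.
  by rewrite /= -(eqP (valP L)) closureS // subUset sub1set xL.
have := noX X; rewrite KX /= properE XL negbK => LX.
have eqL : val L = val X by apply/eqP; rewrite eqEsubset LX.
apply/eqP; rewrite eqn_leq rk_lt // andbT eqL /= rk_closure.
have := rk_submod M [set x] (val K); have := rk_le_card M [set x].
rewrite cards1 => r1 /(leq_trans (leq_addr _ _)) /leq_trans -> //.
by rewrite -add1n leq_add2r.
Qed.

Lemma covers_flatI K K' L : covers K L -> covers K' L ->
  covers (flatI K K') K -> covers (flatI K K') K'.
Proof.
rewrite !coversE => /andP[_ /eqP ->] /andP[_ /eqP[eqr]] /andP[_ /eqP rK].
rewrite -eqr rK eqxx andbT properEneq /= subsetIr andbT.
by apply/eqP => e; move: rK; rewrite /= e eqr => /eqP; rewrite eqn_leq ltnn andbF.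
Qed.

Definition adjacent : rel flat := fun K L => covers K L || covers L K.

(* The flag path (K_1, ..., K_l) is the pair of K_1 and [:: K_2; ...; K_l]. *)
Definition flag_path := {p : flat * seq flat | path adjacent p.1 p.2}.

Definition path_alg := {freeg flag_path / int}.

HB.instance Definition _ := GRing.Lmodule.on path_alg.

(* The basis element (K, s_1, ..., s_k), or 0 if this is not a flag path. *)
Definition fpath K (s : seq flat) : path_alg :=
  if insub (K, s) is Some p then << p >> else 0.

Definition pcat (p q : flag_path) : path_alg :=
  let: (K, s) := val p in let: (L, t) := val q in
  if last K s == L then fpath K (s ++ t) else 0.

Definition path_mul (a b : path_alg) : path_alg :=
  fglift (fun p => fglift (pcat p) b) a.

Definition path_one : path_alg := \sum_(K : flat) fpath K [::].

Lemma path_alg_morph_eq (V : zmodType) (f g : path_alg -> V) :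
    zmod_morphism f -> zmod_morphism g -> (forall p, f << p >> = g << p >>) ->
  f =1 g.
Proof.
move=> fB gB eq_fg a.
pose F := HB.pack_for {additive path_alg -> V} f
  (GRing.isZmodMorphism.Build path_alg V f fB).
pose H := HB.pack_for {additive path_alg -> V} g
  (GRing.isZmodMorphism.Build path_alg V g gB).
rewrite -(freeg_sumE a) -[f]/(F : _ -> _) -[g]/(H : _ -> _) !raddf_sum.
apply: eq_bigr => p _.
have -> : << coeff p a *g p >> = << p >> *~ coeff p a :> path_alg.
  by rewrite freeg_mulz intz.
by rewrite !raddfMz /= eq_fg.
Qed.

Fact path_mulBl b : zmod_morphism (path_mul^~ b).
Proof. exact: lift_is_additive. Qed.

Fact path_mulBr a : zmod_morphism (path_mul a).
Proof.
move=> b c; apply: (path_alg_morph_eq (f := path_mul^~ (b - c))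
  (g := fun a => path_mul a b - path_mul a c)) => [|x y|p].
- exact: path_mulBl.
- by rewrite !path_mulBl !opprD addrACA.
- by rewrite /path_mul !liftU !scale1r lift_is_additive.
Qed.

Lemma path_mulE p q : path_mul << p >> << q >> = pcat p q.
Proof. by rewrite /path_mul !liftU !scale1r. Qed.

Lemma fpathE p : fpath (val p).1 (val p).2 = << p >>.
Proof. by rewrite /fpath -surjective_pairing valK. Qed.

Variant pcat_spec (p q : flag_path) : path_alg -> Prop :=
| PCatNone of last (val p).1 (val p).2 != (val q).1 : pcat_spec p q 0
| PCatSome (r : flag_path) of last (val p).1 (val p).2 = (val q).1 &
    val r = ((val p).1, (val p).2 ++ (val q).2) : pcat_spec p q << r >>.

Lemma pcatP p q : pcat_spec p q (pcat p q).
Proof.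
rewrite /pcat; case: p q => [[K s] /= Ks] [[L t] /= Lt].
case: eqP => [eqL|/eqP neqL]; last exact: PCatNone.
have Kst : path adjacent K (s ++ t) by rewrite cat_path Ks eqL.
pose r : flag_path := Sub (K, s ++ t) Kst.
have -> : fpath K (s ++ t) = << r >> by rewrite -fpathE.
by apply: PCatSome.
Qed.

Fact path_mulA : associative path_mul.
Proof.
move=> a b c.
apply: (path_alg_morph_eq (f := fun a => path_mul a (path_mul b c))
  (g := fun a => path_mul (path_mul a b) c)) a => [|x y|p].
- exact: path_mulBl.
- by rewrite !path_mulBl.
apply: (path_alg_morph_eq (f := fun b => path_mul << p >> (path_mul b c))
  (g := fun b => path_mul (path_mul << p >> b) c)) b => [x y|x y|q].
- by rewrite path_mulBl path_mulBr.
- by rewrite path_mulBr path_mulBl.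
apply: (path_alg_morph_eq (f := fun c => path_mul << p >> (path_mul << q >> c))
  (g := fun c => path_mul (path_mul << p >> << q >>) c)) c => [x y|x y|r].
- by rewrite !path_mulBr.
- by rewrite path_mulBr.
have pm0 a : path_mul a 0 = 0 by rewrite -{1}(subrr 0) path_mulBr subrr.
have p0m a : path_mul 0 a = 0 by rewrite -{1}(subrr 0) path_mulBl subrr.
rewrite !path_mulE; case: (pcatP q r) => [nqr|qr eqr Eqr];
  case: (pcatP p q) => [npq|pq epq Epq]; rewrite ?pm0 ?p0m ?path_mulE //.
- case: pcatP => // pqr; rewrite Epq /= last_cat epq => eqr.
  by rewrite eqr eqxx in nqr.
- by case: pcatP => // pqr; rewrite Eqr /= => epq; rewrite epq eqxx in npq.
case: pcatP => [|u _ Eu]; first by rewrite Eqr /= epq eqxx.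
case: pcatP => [|v _ Ev]; first by rewrite Epq /= last_cat epq eqr eqxx.
congr << _ >>; apply: val_inj.
by rewrite Eu Ev Epq Eqr /= catA.
Qed.

Lemma fpath_nil K : {p : flag_path | val p = (K, [::]) & fpath K [::] = << p >>}.
Proof.
pose p : flag_path := Sub (K, [::]) isT.
by exists p; rewrite -?fpathE.
Qed.

Fact path_mul1l : left_id path_one path_mul.
Proof.
apply: (path_alg_morph_eq (f := path_mul path_one) (g := id)) => // [|q].
  exact: path_mulBr.
rewrite /path_one.
pose F := HB.pack_for {additive path_alg -> path_alg} (path_mul^~ << q >>)
  (GRing.isZmodMorphism.Build path_alg path_alg _ (path_mulBl << q >>)).
rewrite -[LHS]/(F _) raddf_sum (bigD1 (val q).1) //= big1 ?addr0 => [|K neK].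
  have [p Ep ->] := fpath_nil (val q).1; rewrite path_mulE.
  case: pcatP => [|r _ Er]; first by rewrite Ep eqxx.
  by congr << _ >>; apply: val_inj; rewrite Er Ep; case: (val q).
have [p Ep ->] := fpath_nil K; rewrite path_mulE.
by case: pcatP => // r; rewrite Ep => eK; rewrite -eK eqxx in neK.
Qed.

Fact path_mul1r : right_id path_one path_mul.
Proof.
apply: (path_alg_morph_eq (f := path_mul^~ path_one) (g := id)) => // [|q].
  exact: path_mulBl.
rewrite /path_one.
pose F := HB.pack_for {additive path_alg -> path_alg} (path_mul << q >>)
  (GRing.isZmodMorphism.Build path_alg path_alg _ (path_mulBr << q >>)).
rewrite -[LHS]/(F _) raddf_sum (bigD1 (last (val q).1 (val q).2)) //=.
rewrite big1 ?addr0 => [|K neK].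
  have [p Ep ->] := fpath_nil (last (val q).1 (val q).2); rewrite path_mulE.
  case: pcatP => [|r _ Er]; first by rewrite Ep eqxx.
  by congr << _ >>; apply: val_inj; rewrite Er Ep cats0; case: (val q).
have [p Ep ->] := fpath_nil K; rewrite path_mulE.
by case: pcatP => // r; rewrite Ep => eK; rewrite eK eqxx in neK.
Qed.

Fact path_mulDl : left_distributive path_mul +%R.
Proof.
move=> a b c; pose F := HB.pack_for {additive path_alg -> path_alg}
  (path_mul^~ c) (GRing.isZmodMorphism.Build path_alg path_alg _ (path_mulBl c)).
exact: (raddfD F).
Qed.

Fact path_mulDr : right_distributive path_mul +%R.
Proof.
move=> a b c; pose F := HB.pack_for {additive path_alg -> path_alg}
  (path_mul a) (GRing.isZmodMorphism.Build path_alg path_alg _ (path_mulBr a)).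
exact: (raddfD F).
Qed.

HB.instance Definition _ := GRing.Zmodule_isPzRing.Build path_alg
  path_mulA path_mul1l path_mul1r path_mulDl path_mulDr.

(* In [relator_modular], K :&: K' is also covered by K' (lemma [covers_flatI]),
   so that both sequences are flag paths. *)
Inductive relator : path_alg -> Prop :=
| relator_up L K of val L \proper val K & rk M (val K) = (rk M (val L)).+2 :
    relator (\sum_(X : flat | covers L X && covers X K) fpath L [:: X; K])
| relator_down L K of val L \proper val K & rk M (val K) = (rk M (val L)).+2 :
    relator (\sum_(X : flat | covers L X && covers X K) fpath K [:: X; L])
| relator_same K L of covers K L :
    relator (fpath K [:: L; K] - fpath K [::] *+ #|val L :\: val K|)
| relator_modular K K' L of covers K L & covers K' L & K != K' &
    covers (flatI K K') K :
    relator (fpath K [:: L; K'] + fpath K [:: flatI K K'; K'])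
| relator_nonmodular K K' L of covers K L & covers K' L & K != K' &
    ~~ covers (flatI K K') K :
    relator (fpath K [:: L; K']).

Definition S_alg := quot_ring relator.

HB.instance Definition _ := GRing.PzRing.on S_alg.

End Matroid.

Section Exterior.
Context {d : Order.disp_t} (E : finOrderType d).
Implicit Types A B C S T : {set E}.

(* [x S] is the coefficient of e_S in [x]. *)
Definition ext := {ffun {set E} -> int}.

HB.instance Definition _ := GRing.Zmodule.on ext.

Definition mono S : ext := [ffun T => (T == S)%:R].

Definition gen (s : E) : ext := mono [set s].

(* e_A /\ e_B = shuffle_sign A B * e_(A :|: B) for disjoint A and B. *)
Definition shuffle_sign A B : int :=
  (-1) ^+ #|[set p : E * E | [&& p.1 \in A, p.2 \in B & (p.2 < p.1)%O]]|.

Definition wedge (x y : ext) : ext :=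
  [ffun S : {set E} =>
    \sum_(A : {set E} | A \subset S) shuffle_sign A (S :\: A) * x A * y (S :\: A)].

Lemma shuffle_signUl A B C : [disjoint A & B] ->
  shuffle_sign (A :|: B) C = shuffle_sign A C * shuffle_sign B C.
Proof.
move=> dAB; rewrite /shuffle_sign -exprD -cardsUI [X in (_ + X)%N]eq_card0.
  rewrite addn0; congr (_ ^+ _); apply: eq_card => p; rewrite !inE.
  by rewrite andb_orl.
move=> p; rewrite !inE; apply/negP => /andP[/and3P[pA _ _] /and3P[pB _ _]].
by rewrite (disjointFr dAB pA) in pB.
Qed.

Lemma shuffle_signUr A B C : [disjoint B & C] ->
  shuffle_sign A (B :|: C) = shuffle_sign A B * shuffle_sign A C.
Proof.
move=> dBC; rewrite /shuffle_sign -exprD -cardsUI [X in (_ + X)%N]eq_card0.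
  rewrite addn0; congr (_ ^+ _); apply: eq_card => p; rewrite !inE.
  by rewrite andb_orl andb_orr.
move=> p; rewrite !inE; apply/negP => /andP[/and3P[_ pB _] /and3P[_ pC _]].
by rewrite (disjointFr dBC pB) in pC.
Qed.

Lemma shuffle_sign0 A : shuffle_sign set0 A = 1.
Proof. by rewrite /shuffle_sign eq_card0 // => p; rewrite !inE. Qed.

Lemma shuffle_sign0r A : shuffle_sign A set0 = 1.
Proof. by rewrite /shuffle_sign eq_card0 // => p; rewrite !inE andbF. Qed.

Fact wedgeA : associative wedge.
Proof.
move=> x y z; apply/ffunP => S; rewrite !ffunE.
transitivity (\sum_(A : {set E} | A \subset S)
    \sum_(C : {set E} | (C :\: A \subset S :\: A) && (A :|: (C :\: A) == C))
      shuffle_sign A (S :\: A) * x A * (shuffle_sign (C :\: A)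
        ((S :\: A) :\: (C :\: A)) * y (C :\: A) * z ((S :\: A) :\: (C :\: A)))).
  apply: eq_bigr => A sAS; rewrite ffunE mulr_sumr.
  rewrite (reindex_onto (fun C => C :\: A) (fun B => A :|: B)) //= => B.
  rewrite subsetD => /andP[_ dBA].
  by rewrite setDUl setDv set0U; apply/setDidPl.
under [RHS]eq_bigr => C sCS do rewrite ffunE mulr_sumr mulr_suml.
rewrite [RHS](exchange_big_dep (fun A => A \subset S)) /=; last first.
  by move=> C A sCS sAC; apply: subset_trans sCS.
apply: eq_bigr => A sAS; apply: eq_big => [C|C /andP[sCD /eqP sAC]].
  apply/andP/andP => [[sCD /eqP <-]|[sCS sAC]].
    rewrite subUset sAS subsetUl; split=> //.
    by rewrite (subset_trans sCD) // subsetDl.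
  by rewrite setSD // setDE setUIr setUCr setIT (setUidPr sAC).
have {}sAC : A \subset C by rewrite -sAC subsetUl.
have sCS : C \subset S.
  apply/subsetP=> t tC; have [tA|tNA] := boolP (t \in A); first exact: (subsetP sAS).
  have : t \in C :\: A by rewrite inE tNA.
  by move/(subsetP sCD); rewrite inE => /andP[].
have dD : [disjoint C :\: A & S :\: C].
  rewrite disjoints_subset; apply/subsetP=> t; rewrite !inE.
  by case/andP=> _ ->.
have dA : [disjoint A & C :\: A].
  by rewrite disjoint_sym disjoints_subset subDset setUCr subsetT.
have eSA : S :\: A = (C :\: A) :|: (S :\: C).
  apply/setP=> t; rewrite !inE.
  have := subsetP sAC t; have := subsetP sCS t.
  by case: (t \in A); case: (t \in C); case: (t \in S) => // h1 h2;
    rewrite ?(h1 isT) // ?(h2 isT) //; move: (h1 isT).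
have eSAC : (S :\: A) :\: (C :\: A) = S :\: C.
  by rewrite eSA setDUl setDv set0U; apply/setDidPl; rewrite disjoint_sym.
have eC : C = A :|: (C :\: A) by rewrite setDE setUIr setUCr setIT (setUidPr sAC).
have -> : shuffle_sign C (S :\: C) =
    shuffle_sign A (S :\: C) * shuffle_sign (C :\: A) (S :\: C).
  by rewrite -shuffle_signUl // -eC.
rewrite eSAC [in LHS]eSA shuffle_signUr //.
move: (shuffle_sign _ _) (shuffle_sign _ _) (shuffle_sign _ _) => a b c.
move: (x _) (y _) (z _) => u v w.
ring.
Qed.

Fact wedge1l : left_id (mono set0) wedge.
Proof.
move=> x; apply/ffunP=> S; rewrite ffunE (bigD1 set0) ?sub0set //=.
rewrite big1 ?addr0 => [|A /andP[_ /negPf A0]]; rewrite !ffunE ?eqxx.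
  by rewrite shuffle_sign0 setD0 !mul1r.
by rewrite A0 mulr0 mul0r.
Qed.

Fact wedge1r : right_id (mono set0) wedge.
Proof.
move=> x; apply/ffunP=> S; rewrite ffunE (bigD1 S) //=.
rewrite big1 ?addr0 => [|A /andP[sAS neAS]]; rewrite !ffunE.
  by rewrite setDv eqxx shuffle_sign0r mulr1 mul1r.
case: eqP => [/eqP|]; last by rewrite mulr0.
by rewrite setD_eq0 => sSA; rewrite eqEsubset sAS sSA in neAS.
Qed.

Fact wedgeDl : left_distributive wedge +%R.
Proof.
move=> x y z; apply/ffunP=> S; rewrite !ffunE -big_split /=.
by apply: eq_bigr => A _; rewrite ffunE mulrDr mulrDl.
Qed.

Fact wedgeDr : right_distributive wedge +%R.
Proof.
move=> x y z; apply/ffunP=> S; rewrite !ffunE -big_split /=.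
by apply: eq_bigr => A _; rewrite ffunE mulrDr.
Qed.

HB.instance Definition _ := GRing.Zmodule_isPzRing.Build ext
  wedgeA wedge1l wedge1r wedgeDl wedgeDr.

Lemma ext_coefMz (x : ext) (n : int) S : (x *~ n) S = x S *~ n.
Proof. by case: n => n; rewrite ?NegzE ?mulrNz -!pmulrn ?ffunE ffunMnE. Qed.

Lemma ext_monoE (x : ext) : x = \sum_(S : {set E}) mono S *~ x S.
Proof.
apply/ffunP=> S; rewrite sum_ffunE (bigD1 S) //= big1 ?addr0 => [|T neTS].
  by rewrite ext_coefMz ffunE eqxx intz.
by rewrite ext_coefMz ffunE eq_sym (negPf neTS) mul0rz.
Qed.

Lemma monoM A B : mono A * mono B =
  if [disjoint A & B] then mono (A :|: B) *~ shuffle_sign A B else 0.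
Proof.
apply/ffunP => S; transitivity (wedge (mono A) (mono B) S) => //.
have [sAS|NsAS] := boolP (A \subset S); last first.
  rewrite ffunE big1 => [|C sCS]; last first.
    rewrite !ffunE; case: eqP => [eCA|_]; last by rewrite mulr0 mul0r.
    by rewrite -eCA sCS in NsAS.
  case: ifP => _; rewrite ?ext_coefMz ffunE //; case: eqP => [eS|_].
    by rewrite eS subsetUl in NsAS.
  by rewrite mul0rz.
rewrite ffunE (bigD1 A) //= big1 ?addr0 => [|C /andP[_ /negPf neC]]; last first.
  by rewrite !ffunE neC mulr0 mul0r.
rewrite !ffunE eqxx mulr1; case: eqP => [eB|neB].
  rewrite -eB disjoint_sym disjoints_subset setDE subsetIr ext_coefMz ffunE.
  rewrite (_ : S == _) ?mulr1 ?intz // eq_sym; apply/eqP.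
  by rewrite setUIr setUCr setIT (setUidPr sAS).
rewrite mulr0; case: ifP => [dAB|_]; rewrite ?ffunE // ext_coefMz ffunE.
case: eqP => [eS|_]; last by rewrite mul0rz.
case: neB; rewrite eS setDUl setDv set0U; apply/setDidPl.
by rewrite disjoint_sym.
Qed.

Lemma gen_sqr s : gen s * gen s = 0.
Proof. by rewrite monoM disjoints1 inE eqxx. Qed.

Lemma gen_anticomm s t : gen s * gen t = - (gen t * gen s).
Proof.
have [<-|neqst] := eqVneq s t; first by rewrite gen_sqr oppr0.
rewrite !monoM !disjoints1 !inE neqst eq_sym neqst [in RHS]setUC -mulrNz.
congr (_ *~ _); rewrite /shuffle_sign.
have card1 (u v : E) :
    #|[set p : E * E | [&& p.1 \in [set u], p.2 \in [set v] & (p.2 < p.1)%O]]|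
    = (v < u)%O.
  rewrite (_ : [set p | _] = if (v < u)%O then [set (u, v)] else set0).
    by case: ifP; rewrite ?cards1 ?cards0.
  apply/setP=> -[a b]; rewrite !inE /=; case: ifP => vu; rewrite !inE ?xpair_eqE.
    by case: eqP => [->|] //; case: eqP => [->|].
  by case: eqP => [->|] //; case: eqP => [->|].
by rewrite !card1; case: ltgtP neqst => // _ _; rewrite ?expr1 ?expr0 ?opprK.
Qed.

Lemma mono_sorted (s : seq E) :
  sorted <%O s -> \prod_(t <- s) gen t = mono [set t in s].
Proof.
elim: s => [_|t s IH].
  by rewrite big_nil; congr mono; apply/setP=> t; rewrite !inE.
rewrite /= lt_path_sortedE => /andP[/allP lt_ts /IH eq_s].
rewrite big_cons eq_s monoM disjoints1 inE.
have -> : (t \in s) = false by apply/negP => /lt_ts; rewrite ltxx.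
rewrite /shuffle_sign eq_card0 ?expr0 ?mulr1z => [|p].
  by congr mono; apply/setP=> u; rewrite !inE.
rewrite !inE; apply/negP => /and3P[/eqP-> /lt_ts lt1 lt2].
by have := lt_trans lt1 lt2; rewrite ltxx.
Qed.

(* e_S = s_1 /\ ... /\ s_p for S = {s_1 < ... < s_p}. *)
Lemma mono_prod S : mono S = \prod_(s <- sort <=%O (enum S)) gen s.
Proof.
rewrite mono_sorted ?sort_lt_sorted ?enum_uniq //.
by congr mono; apply/setP=> t; rewrite inE mem_sort mem_enum.
Qed.

End Exterior.

Section Btilde.
Context {d : Order.disp_t} {E : finOrderType d} (M : matroid E).
Implicit Types (F G H : flat M) (B : {set E}).

(* B^G_F, the span of the e_B for B a basis of M^G_F; it is 0 unless F \subset G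
   by definition of [minor_basis]. *)
Definition Bmod F G : {pred ext E} :=
  fun x => [forall B, (x B != 0) ==> minor_basis M (val F) (val G) B].

Lemma BmodP F G (x : ext E) :
  reflect (forall B, ~~ minor_basis M (val F) (val G) B -> x B = 0)
          (x \in Bmod F G).
Proof.
apply: (iffP forallP) => [xF B|xF B]; last first.
  by apply/implyP; apply: contraR => /xF->; rewrite eqxx.
by have /implyP := xF B => h /(contraNN h); rewrite negbK => /eqP.
Qed.

Fact Bmod_zmod_closed F G : zmod_closed (Bmod F G).
Proof.
split=> [|x y /BmodP Bx /BmodP By]; apply/BmodP => B NB; rewrite !ffunE //.
by rewrite Bx // By // subrr.
Qed.

HB.instance Definition _ F G :=
  GRing.isZmodClosed.Build (ext E) (Bmod F G) (Bmod_zmod_closed F G).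

Lemma BmodM F G H (x y : ext E) :
  x \in Bmod G H -> y \in Bmod F G -> x * y \in Bmod F H.
Proof.
move=> /BmodP Bx /BmodP By; apply/BmodP => B NB.
rewrite -[(x * y) B]/(wedge x y B) ffunE big1 // => A sAB.
have [bA|/Bx->] := boolP (minor_basis M (val G) (val H) A); last first.
  by rewrite mulr0 mul0r.
have [bBA|/By->] := boolP (minor_basis M (val F) (val G) (B :\: A)); last first.
  by rewrite mulr0.
case/negP: NB; have := minor_basisU bBA bA.
by rewrite setDE setUIr setUCr setIT (setUidPr sAB).
Qed.

(* The component of an element of the direct sum in B^G_F is its value at
   (F, G). *)
Definition in_Btilde : {pred {ffun flat M * flat M -> ext E}} :=
  fun b => [forall p, b p \in Bmod p.1 p.2].

Fact in_Btilde_zmod_closed : zmod_closed in_Btilde.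
Proof.
split=> [|b c /forallP Bb /forallP Bc]; apply/forallP => p; rewrite !ffunE.
  exact: rpred0.
exact: rpredB.
Qed.

Record Btilde := MkBtilde {
  Bcomp :> {ffun flat M * flat M -> ext E};
  Bcomp_in : Bcomp \in in_Btilde }.

HB.instance Definition _ := [isSub for Bcomp].
HB.instance Definition _ := [Choice of Btilde by <:].
HB.instance Definition _ := GRing.SubChoice_isSubZmodule.Build
  {ffun flat M * flat M -> ext E} in_Btilde Btilde in_Btilde_zmod_closed.

Implicit Types b x y u : Btilde.

Lemma BcompP b F G : b (F, G) \in Bmod F G.
Proof. exact: (forallP (Bcomp_in b) (F, G)). Qed.

Lemma Btilde_eqP x y : (forall F G, x (F, G) = y (F, G)) -> x = y.
Proof. by move=> eqxy; apply: val_inj; apply/ffunP => -[F G]; apply: eqxy. Qed.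

Lemma BcompB x y p : (x - y) p = x p - y p.
Proof. by rewrite -[Bcomp _]/(val _) raddfB !ffunE. Qed.

Definition star_fun b x : {ffun flat M * flat M -> ext E} :=
  [ffun p => \sum_(G : flat M) b (G, p.2) * x (p.1, G)].

Fact star_in b x : star_fun b x \in in_Btilde.
Proof.
apply/forallP => -[F H]; rewrite ffunE /=; apply: rpred_sum => G _.
by apply: (@BmodM F G H); apply: BcompP.
Qed.

Definition star b x : Btilde := MkBtilde (star_in b x).

Fact star_additive b : zmod_morphism (star b).
Proof.
move=> x y; apply: Btilde_eqP => F G; rewrite BcompB !ffunE -sumrB.
by apply: eq_bigr => H _; rewrite BcompB mulrBr.
Qed.

Definition mu b : endz Btilde := Endz (star_additive b).

(* The form for which the e_B, B a basis of M^G_F, form an orthonormal basis. *)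
Definition form x y : int :=
  \sum_(p : flat M * flat M) \sum_(B : {set E}) x p B * y p B.

Lemma formC x y : form x y = form y x.
Proof. by apply: eq_bigr => p _; apply: eq_bigr => B _; rewrite mulrC. Qed.

Fact form_additive x : zmod_morphism (form x).
Proof.
move=> y y'; rewrite /form -sumrB; apply: eq_bigr => p _.
by rewrite -sumrB; apply: eq_bigr => B _; rewrite BcompB !ffunE mulrBr.
Qed.

HB.instance Definition _ x :=
  GRing.isZmodMorphism.Build Btilde int (form x) (form_additive x).

Definition Bindex := {t : flat M * flat M * {set E} |
  minor_basis M (val t.1.1) (val t.1.2) t.2}.

Definition Bvec_fun (t : Bindex) : {ffun flat M * flat M -> ext E} :=
  [ffun p => if p == (val t).1 then mono (val t).2 else 0].

Fact Bvec_in t : Bvec_fun t \in in_Btilde.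
Proof.
apply/forallP => p; rewrite ffunE; case: eqP => [->|_]; last exact: rpred0.
apply/BmodP => B NB; rewrite ffunE; case: eqP => // eB.
by rewrite eB (valP t) in NB.
Qed.

(* The monomial e_B in the summand B^G_F, for t = (F, G, B). *)
Definition Bvec t : Btilde := MkBtilde (Bvec_in t).

Lemma form_Bvec x t : form x (Bvec t) = x (val t).1 (val t).2.
Proof.
rewrite /form (bigD1 (val t).1) //= [X in _ + X]big1 ?addr0 => [|p /negPf np]; last first.
  by rewrite big1 // => B _; rewrite !ffunE np ffunE mulr0.
rewrite (bigD1 (val t).2) //= big1 ?addr0 => [|B /negPf nB].
  by rewrite !ffunE eqxx !ffunE eqxx mulr1.
by rewrite !ffunE eqxx ffunE nB mulr0.
Qed.

Lemma form_Bvec_orthonormal s t : form (Bvec s) (Bvec t) = (s == t)%:R.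
Proof.
rewrite form_Bvec !ffunE -val_eqE -pair_eqE /= eq_sym.
by rewrite /pair_eq; case: eqP => _; rewrite !ffunE //= eq_sym.
Qed.

Lemma form_eqP x y : (forall t, form x (Bvec t) = form y (Bvec t)) -> x = y.
Proof.
move=> eqxy; apply: Btilde_eqP => F G; apply/ffunP => B.
have [bB|NB] := boolP (minor_basis M (val F) (val G) B).
  by have := eqxy (Sub (F, G, B) bB); rewrite !form_Bvec.
by have /BmodP -> // := BcompP x F G; have /BmodP -> // := BcompP y F G.
Qed.

Lemma Btilde_basis x : x = \sum_(t : Bindex) Bvec t *~ form x (Bvec t).
Proof.
apply: form_eqP => t; rewrite [RHS]formC raddf_sum /= (bigD1 t) //=.
rewrite big1 ?addr0 => [|s neqst].
  by rewrite raddfMz /= form_Bvec_orthonormal eqxx intz.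
by rewrite raddfMz /= form_Bvec_orthonormal eq_sym (negPf neqst) mul0rz.
Qed.

Definition adjoint_fun (f : endz Btilde) y : Btilde :=
  \sum_(t : Bindex) Bvec t *~ form (f (Bvec t)) y.

Fact adjoint_additive f : zmod_morphism (adjoint_fun f).
Proof.
move=> x y; rewrite /adjoint_fun -sumrB; apply: eq_bigr => t _.
by rewrite raddfB mulrzBr.
Qed.

Definition adjoint f : endz Btilde := Endz (adjoint_additive f).

Lemma adjointP (f : endz Btilde) x y : form (f x) y = form x (adjoint f y).
Proof.
rewrite raddf_sum [in LHS](Btilde_basis x) raddf_sum formC raddf_sum /=.
apply: eq_bigr => t _; rewrite !raddfMz /= formC.
by move: (form (f _) y) (form x _) => m n; rewrite !mulrzz mulrC.
Qed.

Lemma adjoint_unique (f g : endz Btilde) :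
  (forall x y, form (f x) y = form x (g y)) -> g = adjoint f.
Proof.
move=> fg; apply: endzP => y; apply: form_eqP => t.
by rewrite formC -fg adjointP formC.
Qed.

Definition kappa b : endz Btilde := adjoint (mu b).

Definition Ucheck : {pred Btilde} := fun u =>
  [forall F : flat M, forall G : flat M, (val F \subset val G) ==>
    ((\sum_(s in val G :\: val F) gen s) * u (F, G) == 0)].

Definition mu_kappa (f : endz Btilde) : Prop :=
  exists2 u, u \in Ucheck & f = mu u \/ f = kappa u.

Definition End_subalg := subring mu_kappa.

HB.instance Definition _ := GRing.PzRing.on End_subalg.

End Btilde.

(* Main.v *)
(** Send a path (K_1, ..., K_l) to the composite of its steps, an up step
    K <. L acting as kappa_u and the down step L .> K as mu_u for the sum u of
    L \ K, the element spanning the check-U^L_K. The wedge relation follows from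
    the anticommutation iota_s (t /\ x) + t /\ iota_s x = delta_st x, and (FS)
    from u_K * u_K = 0, where u_K is the sum of K \ L and splits as the sum of
    X \ L plus the sum of K \ X for each intermediate X.

    For F below G call a flag from F to G nbc if for each of its flats X
    other than F the least element of X \ F lies in no smaller flat of the
    flag; these least elements form a basis of M^G_F. Modulo (FS) every flag
    is a combination of nbc flags, the products of the u's along nbc flags
    span check-U^G_F, and in such a product the coefficient of the basis of
    another nbc flag vanishes. The wedge relation turns every path into a
    combination of valleys: a descending flag from K to N followed by an
    ascending flag from N to K'. Hence S(M) is spanned by the valleys of nbc
    flags, which act as mu_a kappa_b with a, b in the dual systems above;
    these operators are linearly independent and generate the algebra. *)
From HB Require Import structures.
From mathcomp Require Import all_boot all_order all_algebra.
From mathcomp Require Import boolp freeg ring.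
Require Import Defs.

Set Implicit Arguments.
Unset Strict Implicit.
Unset Printing Implicit Defensive.

Import Order.TTheory GRing.Theory Num.Theory.

Local Open Scope ring_scope.

(** * Integral spans and contraction in the exterior algebra *)

Inductive in_span (V : zmodType) (G : V -> Prop) : V -> Prop :=
| in_span_gen x : G x -> in_span G x
| in_span0 : in_span G 0
| in_spanB x y : in_span G x -> in_span G y -> in_span G (x - y).

Section Span.
Variables (V W : zmodType) (G : V -> Prop).

Lemma in_spanN x : in_span G x -> in_span G (- x).
Proof. by move=> Gx; rewrite -sub0r; apply: in_spanB => //; apply: in_span0. Qed.

Lemma in_spanD x y : in_span G x -> in_span G y -> in_span G (x + y).
Proof. by move=> Gx Gy; rewrite -[y]opprK; apply/in_spanB/in_spanN. Qed.

Lemma in_span_sum I (r : seq I) (P : pred I) (F : I -> V) :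
  (forall i, P i -> in_span G (F i)) -> in_span G (\sum_(i <- r | P i) F i).
Proof. by move=> GF; apply: big_ind => //; [exact: in_span0 | exact: in_spanD]. Qed.

Lemma in_spanMn x n : in_span G x -> in_span G (x *+ n).
Proof.
move=> Gx; elim: n => [|n IH]; first by rewrite mulr0n; apply: in_span0.
by rewrite mulrS; apply: in_spanD.
Qed.

Lemma in_spanMz x (n : int) : in_span G x -> in_span G (x *~ n).
Proof.
move=> Gx; case: n => n; first exact: in_spanMn.
by rewrite NegzE mulrNz; apply/in_spanN/in_spanMn.
Qed.

Lemma in_span_map (H : W -> Prop) (f : V -> W) : zmod_morphism f ->
  (forall x, G x -> in_span H (f x)) -> forall x, in_span G x -> in_span H (f x).
Proof.
move=> fB GH x; elim=> [y /GH //||y z _ Hy _ Hz].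
  by rewrite -(subr0 0) fB subrr; apply: in_span0.
by rewrite fB; apply: in_spanB.
Qed.

End Span.

(** Collects a span over a finite index type into a single sum, which makes the coefficients
    available for the linear independence argument. *)
Lemma in_span_comb (V : zmodType) (I : finType) (P : pred I) (g : I -> V) x :
    in_span (fun y => exists2 i, P i & y = g i) x ->
  exists c : I -> int, x = \sum_(i | P i) g i *~ c i.
Proof.
elim=> [y [i Pi ->]||y z _ [c ->] _ [c' ->]].
- exists (fun j => (j == i)%:Z); rewrite (bigD1 i) //= eqxx mulr1z big1 ?addr0 //.
  by move=> j /andP[_ /negPf ->]; rewrite mulr0z.
- by exists (fun _ => 0); rewrite big1 // => i _; rewrite mulr0z.
- exists (fun i => c i - c' i); rewrite -sumrB; apply: eq_bigr => i _.
  by rewrite mulrzBr.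
Qed.

(** * Interior products and the monomial form on the exterior algebra *)

Section Contraction.
Context {d : Order.disp_t} {E : finOrderType d}.
Implicit Types (x y : ext E) (A B S T : {set E}) (s t : E).

Lemma ext_mulE x y S :
  (x * y) S = \sum_(A : {set E} | A \subset S) shuffle_sign A (S :\: A) * x A * y (S :\: A).
Proof. by rewrite -[(x * y) S]/(wedge x y S) ffunE. Qed.

Lemma gen_mulE s x S : (gen s * x) S =
  if s \in S then shuffle_sign [set s] (S :\ s) * x (S :\ s) else 0.
Proof.
rewrite ext_mulE; case: ifP => [sS|sNS].
  rewrite (bigD1 [set s]) ?sub1set //= big1 ?addr0.
    by rewrite ffunE eqxx mulr1.
  by move=> A /andP[_ /negPf neA]; rewrite ffunE neA mulr0 mul0r.
apply: big1 => A sAS; rewrite ffunE; case: eqP => [eA|]; last by rewrite mulr0 mul0r.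
by rewrite eA sub1set sNS in sAS.
Qed.

(** The interior product by [s], adjoint to left multiplication by [gen s] (see [ip_gen_mul]). *)
Definition contr s x : ext E :=
  [ffun S : {set E} => if s \in S then 0 else shuffle_sign [set s] S * x (s |: S)].

Lemma contrE s x S :
  contr s x S = if s \in S then 0 else shuffle_sign [set s] S * x (s |: S).
Proof. by rewrite ffunE. Qed.

Lemma extBE x y S : (x - y) S = x S - y S. Proof. by rewrite !ffunE. Qed.

Lemma contr_additive s : zmod_morphism (contr s).
Proof.
move=> x y; apply/ffunP=> S; rewrite !ffunE; case: ifP => _; first by rewrite subr0.
by rewrite mulrBr.
Qed.

HB.instance Definition _ s :=
  GRing.isZmodMorphism.Build (ext E) (ext E) (contr s) (contr_additive s).

Lemma shuffle_sign_sqr A B : shuffle_sign A B * shuffle_sign A B = 1.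
Proof. by rewrite /shuffle_sign -expr2 sqrr_sign. Qed.

Lemma shuffle_sign1C s t : s != t ->
  shuffle_sign [set s] [set t] = - shuffle_sign [set t] [set s].
Proof.
move=> nst; have /ffunP/(_ [set s; t]) := gen_anticomm s t.
rewrite !monoM !disjoints1 !inE nst eq_sym nst [[set t] :|: _]setUC.
by rewrite [in RHS]ffunE !ext_coefMz !ffunE eqxx !intz.
Qed.

(** The Clifford relation between interior and exterior multiplication. For [s != t] the two sides
    differ by the transposition of [s] and [t], whose sign is [shuffle_sign1C]. *)
Lemma contr_gen_mul s t x :
  contr s (gen t * x) = (if s == t then x else 0) - gen t * contr s x.
Proof.
apply/ffunP=> S; rewrite extBE contrE !gen_mulE !contrE.
have [<-|nst] := eqVneq s t.
  rewrite setU11 !inE eqxx /=; case: ifP => sS.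
    by rewrite setD1K // mulrA shuffle_sign_sqr mul1r subrr.
  rewrite subr0 setU1K ?sS // mulrA shuffle_sign_sqr mul1r.
  by [].
rewrite !inE ffunE nst (eq_sym t) (negPf nst) /= sub0r; case: (boolP (t \in S)) => tS; last first.
  by case: ifP; rewrite ?mulr0 oppr0.
case: ifP => sS; first by rewrite mulr0 oppr0.
have eS : S = t |: (S :\ t) by rewrite setD1K.
have eD : (s |: S) :\ t = s |: (S :\ t).
  by apply/setP=> z; rewrite !inE; case: (eqVneq z s) => [->|]; rewrite ?nst.
rewrite eD {1}eS !shuffle_signUr ?disjoints1 ?inE ?eqxx ?sS ?andbF //.
rewrite (shuffle_sign1C nst).
set a := shuffle_sign [set t] [set s]; set b := shuffle_sign _ _.
set c := shuffle_sign _ _; have aa : a * a = 1 by apply: shuffle_sign_sqr.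
by transitivity (- (a * a) * b * c * x (s |: S :\ t)); [ring | rewrite aa; ring].
Qed.

Definition ip x y : int := \sum_(S : {set E}) x S * y S.

Lemma ipC x y : ip x y = ip y x.
Proof. by apply: eq_bigr => S _; rewrite mulrC. Qed.

Fact ip_additive x : zmod_morphism (ip x).
Proof. by move=> y z; rewrite /ip -sumrB; apply: eq_bigr => S _; rewrite !ffunE mulrBr. Qed.

HB.instance Definition _ x :=
  GRing.isZmodMorphism.Build (ext E) int (ip x) (ip_additive x).

Lemma ip_mono x S : ip x (mono S) = x S.
Proof.
rewrite /ip (bigD1 S) //= ffunE eqxx mulr1 big1 ?addr0 // => T /negPf nT.
by rewrite ffunE nT mulr0.
Qed.

Lemma ip_suml I (r : seq I) (P : pred I) (F : I -> ext E) y :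
  ip (\sum_(i <- r | P i) F i) y = \sum_(i <- r | P i) ip (F i) y.
Proof. by rewrite ipC raddf_sum; apply: eq_bigr => i _; rewrite ipC. Qed.

Lemma ip_gen_mul s x y : ip (gen s * x) y = ip x (contr s y).
Proof.
rewrite /ip (bigID (fun S : {set E} => s \in S)) /= [X in _ + X]big1 ?addr0; last first.
  by move=> S /negPf sS; rewrite gen_mulE sS mul0r.
rewrite [RHS](bigID (fun S : {set E} => s \in S)) /= [X in _ = X + _]big1 ?add0r; last first.
  by move=> S sS; rewrite contrE sS mulr0.
rewrite (reindex_onto (fun S : {set E} => s |: S) (fun S => S :\ s)) /=; last first.
  by move=> S sS; rewrite setD1K.
apply: eq_big => [S|S /andP[_ /eqP eS]].
  rewrite setU11 /=; apply/eqP/idP => [<-|sS]; first by rewrite !inE eqxx.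
  by rewrite setU1K.
have sS : s \notin S by rewrite -eS !inE eqxx.
by rewrite gen_mulE setU11 setU1K // contrE (negPf sS); ring.
Qed.

(** Move [gen s] across the form, anticommute it past [gen t], and move [gen t] back. This is where
    the minus sign of the wedge relation arises. *)
Lemma ip_gen_gen s t x y : ip (gen s * x) (gen t * y) =
  (if s == t then ip x y else 0) - ip (contr t x) (contr s y).
Proof.
rewrite ip_gen_mul contr_gen_mul raddfB /=; congr (_ - _).
  by case: ifP => //; rewrite raddf0.
by rewrite ipC ip_gen_mul ipC.
Qed.

Definition gsum A : ext E := \sum_(s in A) gen s.

Lemma gsum0 : gsum set0 = 0. Proof. exact: big_set0. Qed.

Lemma gsumD A B : A \subset B -> gsum B = gsum A + gsum (B :\: A).
Proof. by move=> sAB; rewrite /gsum (big_setID A) (setIidPr sAB). Qed.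

Lemma gsum_sqr A : gsum A * gsum A = 0.
Proof.
elim: {A}_.+1 {-2}A (ltnSn #|A|) => // n IH A leA.
have [->|[s sA]] := set_0Vmem A; first by rewrite gsum0 mul0r.
have -> : gsum A = gen s + gsum (A :\ s).
  by rewrite /gsum (bigD1 s) //=; congr (_ + _); apply: eq_bigl => t; rewrite !inE andbC.
rewrite mulrDl !mulrDr gen_sqr add0r IH ?addr0; last first.
  by rewrite ltnS (cardsD1 s) sA in leA.
rewrite /gsum mulr_sumr mulr_suml -big_split big1 //= => t _.
by rewrite gen_anticomm addNr.
Qed.

(** Makes [contr m] a contracting homotopy for left multiplication by [gsum A]: if [gsum A * x = 0],
    then [x = gsum A * contr m x]. *)
Lemma contr_gsum m A x : m \in A -> contr m (gsum A * x) = x - gsum A * contr m x.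
Proof.
move=> mA; rewrite /gsum !mulr_suml raddf_sum /=.
under eq_bigr do rewrite contr_gen_mul.
rewrite sumrB; congr (_ - _); rewrite (bigD1 m) //= eqxx big1 ?addr0 //.
by move=> s /andP[_ /negPf]; rewrite eq_sym => ->.
Qed.

End Contraction.

(** * Flats, minors and the operators mu and kappa *)

Section Flats.
Variables (E : finType) (M : matroid E).
Implicit Types (F G K L X : flat M) (A B : {set E}).

Definition fcl A : flat M := Sub (closure M A) (is_flat_closure M A).

Lemma fcl_min A K : (val (fcl A) \subset val K) = (A \subset val K).
Proof.
apply/idP/idP => [|sAK]; first exact/subset_trans/sub_closure.
by rewrite -(eqP (valP K)) closureS.
Qed.

Lemma fcl_flat K : fcl (val K) = K.
Proof. by apply: val_inj; rewrite /= (eqP (valP K)). Qed.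

Lemma flat_rk_eq K L : val K \subset val L -> (rk M (val L) <= rk M (val K))%N -> K = L.
Proof.
move=> sKL leLK; apply/eqP; rewrite -val_eqE eqEproper sKL /=.
by apply/negP => /rk_lt; rewrite ltnNge leLK.
Qed.

Lemma coversP K L : reflect (val K \subset val L /\ rk M (val L) = (rk M (val K)).+1) (covers K L).
Proof.
rewrite coversE; apply: (iffP andP) => [[/proper_sub sKL /eqP]|[sKL rL]] //.
rewrite properEneq sKL rL eqxx andbT; split=> //.
by apply: contra_eq_neq rL => ->; rewrite neq_ltn ltnSn.
Qed.

Lemma rkU1_le A s : (rk M (s |: A) <= (rk M A).+1)%N.
Proof.
apply: leq_trans (leq_trans (leq_addr _ _) (rk_submod M [set s] A)) _.
by rewrite -add1n leq_add2r (leq_trans (rk_le_card M _)) // cards1.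
Qed.

Lemma rk_fclU1 K s : s \notin val K -> rk M (val (fcl (s |: val K))) = (rk M (val K)).+1.
Proof.
move=> sK; rewrite /= rk_closure; apply/eqP; rewrite eqn_leq rkU1_le /=.
rewrite ltn_neqAle rk_mono ?subsetUr // andbT eq_sym.
by apply: contra sK => eqr; rewrite -(eqP (valP K)) inE.
Qed.

Lemma covers_fclU1 K s : s \notin val K -> covers K (fcl (s |: val K)).
Proof.
move=> sK; apply/coversP; split; last exact: rk_fclU1.
exact: subset_trans (subsetUr [set s] _) (sub_closure _ _).
Qed.

Lemma mem_fclU1 K s : s \in val (fcl (s |: val K)).
Proof. by apply: (subsetP (sub_closure _ _)); rewrite setU11. Qed.

Lemma covers_fcl K L s : covers K L -> s \in val L -> s \notin val K -> L = fcl (s |: val K).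
Proof.
move=> /coversP[sKL rL] sL sK; symmetry; apply: flat_rk_eq; last by rewrite rk_fclU1 // rL.
by rewrite fcl_min subUset sub1set sL.
Qed.

Lemma covers_sub K L : covers K L -> val K \subset val L.
Proof. by case/coversP. Qed.

Lemma covers_rk K L : covers K L -> rk M (val L) = (rk M (val K)).+1.
Proof. by case/coversP. Qed.

Lemma minor_basis_cover K L s : covers K L -> s \in val L :\: val K ->
  minor_basis M (val K) (val L) [set s].
Proof.
move=> cKL; rewrite inE => /andP[sK sL]; rewrite /minor_basis covers_sub //=.
rewrite sub1set inE sK sL cards1 (covers_rk cKL) subSn // subnn eqxx /=.
by rewrite setUC (covers_fcl cKL sL sK).
Qed.

Lemma minor_basis_fcl F G B : minor_basis M (val F) (val G) B -> G = fcl (val F :|: B).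
Proof. by case/and4P=> _ _ _ /eqP eG; apply: val_inj. Qed.

Lemma rk_minor_basis F G B : minor_basis M (val F) (val G) B ->
  rk M (val G) = (rk M (val F) + #|B|)%N.
Proof. by case/and4P=> sFG _ /eqP-> _; rewrite subnKC // rk_mono. Qed.

Lemma fclU A B : fcl (A :|: val (fcl B)) = fcl (A :|: B).
Proof. by apply: val_inj; rewrite /= setUC closureU setUC. Qed.

(** Deleting an element of a basis leaves a basis of a hyperplane of the minor. Adding [s] to [X]
    generates [K], and a rank count shows that this must raise the rank by one. *)
Lemma minor_basisD1 F K B s : s \notin B ->
    minor_basis M (val F) (val K) (s |: B) ->
  let X := fcl (val F :|: B) in
  [/\ covers X K, s \notin val X & minor_basis M (val F) (val X) B].
Proof.
move=> sB bK X; have rK := rk_minor_basis bK; rewrite cardsU1 sB addnCA add1n in rK.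
have eK : K = fcl (s |: val X) by rewrite (minor_basis_fcl bK) fclU setUCA.
have sFB : val F :|: B \subset val X by apply: sub_closure.
have leX : (rk M (val X) <= rk M (val F) + #|B|)%N.
  rewrite rk_closure; apply: leq_trans (leq_trans (leq_addr _ _) (rk_submod _ _ _)) _.
  by rewrite leq_add2l rk_le_card.
(* If [s] were in [X], then [K = X], whose rank is at most that of [F] plus [#|B|], one less than
   the rank of [K]. *)
have sX : s \notin val X.
  apply/negP => sX; have eKX : K = X by rewrite eK (setUidPr _) ?sub1set // fcl_flat.
  by move: leX; rewrite -eKX rK ltnn.
have cXK : covers X K by rewrite eK covers_fclU1.
split=> //; apply/and4P; split.
- exact: subset_trans (subsetUl _ _) sFB.
- case/and4P: bK => _ + _ _; rewrite subsetD => /andP[_ dB].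
  rewrite subsetD (subset_trans (subsetUr _ _) sFB) /=.
  exact: disjointWl (subsetUr _ _) dB.
- have := covers_rk cXK; rewrite rK => -[<-]; by rewrite addKn.
- exact: eqxx.
Qed.

Lemma minor_basis0 F G : minor_basis M (val F) (val G) set0 = (F == G).
Proof.
apply/idP/eqP => [/minor_basis_fcl ->|->]; first by rewrite setU0 fcl_flat.
by rewrite /minor_basis subxx sub0set cards0 subnn setU0 (eqP (valP G)) !eqxx.
Qed.

End Flats.
Arguments fcl {E} M A.

(** * Summands of the direct sum and calculus of mu and kappa *)

Section Operators.
Context {d : Order.disp_t} {E : finOrderType d} (M : matroid E).
Implicit Types (F G H K L X : flat M) (A B S T : {set E}) (u v x : ext E) (s t : E).
Implicit Types (b c y z : Btilde M).

(** The orthogonal projection of the exterior algebra onto B^G_F. *)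
Definition minor_proj F G x : ext E :=
  [ffun B : {set E} => if minor_basis M (val F) (val G) B then x B else 0].

Lemma minor_projE F G x B :
  minor_proj F G x B = if minor_basis M (val F) (val G) B then x B else 0.
Proof. by rewrite ffunE. Qed.

Lemma minor_proj_in F G x : minor_proj F G x \in Bmod F G.
Proof. by apply/BmodP=> B /negPf NB; rewrite ffunE NB. Qed.

Lemma minor_proj_id F G x : x \in Bmod F G -> minor_proj F G x = x.
Proof.
by move=> /BmodP xB; apply/ffunP=> B; rewrite ffunE; case: ifP => // /negbT /xB ->.
Qed.

Fact minor_proj_additive F G : zmod_morphism (minor_proj F G).
Proof. by move=> x y; apply/ffunP=> B; rewrite !ffunE; case: ifP => //; rewrite subr0. Qed.

HB.instance Definition _ F G :=
  GRing.isZmodMorphism.Build (ext E) (ext E) (minor_proj F G) (minor_proj_additive F G).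

Definition summand_fun F G x : {ffun flat M * flat M -> ext E} :=
  [ffun p => if p == (F, G) then minor_proj F G x else 0].

Fact summand_in F G x : summand_fun F G x \in (@in_Btilde d E M).
Proof.
apply/forallP => p; rewrite ffunE; case: eqP => [->|_]; last exact: rpred0.
exact: minor_proj_in.
Qed.

(** The inclusion of B^G_F. Projecting first makes it additive on all of [ext E], so that no
    membership proof has to be carried along. *)
Definition summand F G x : Btilde M := MkBtilde (summand_in F G x).

Lemma summandE F G x F' G' :
  summand F G x (F', G') = if (F' == F) && (G' == G) then minor_proj F G x else 0.
Proof. by rewrite ffunE. Qed.

Fact summand_additive F G : zmod_morphism (summand F G).
Proof.
move=> x y; apply: Btilde_eqP => F' G'; rewrite BcompB !summandE.
by case: ifP => _; rewrite ?subr0 // raddfB.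
Qed.

HB.instance Definition _ F G :=
  GRing.isZmodMorphism.Build (ext E) (Btilde M) (summand F G) (summand_additive F G).

Lemma BcompD b c p : (b + c) p = b p + c p.
Proof. by rewrite -[Bcomp _]/(val _) raddfD !ffunE. Qed.

Lemma Bcomp0 p : (0 : Btilde M) p = 0.
Proof. by rewrite -[Bcomp _]/(val _) raddf0 ffunE. Qed.

Lemma Bcomp_sum I (r : seq I) (P : pred I) (f : I -> Btilde M) p :
  (\sum_(i <- r | P i) f i) p = \sum_(i <- r | P i) f i p.
Proof.
apply: (big_morph (fun c : Btilde M => c p)) => [b c|]; first exact: BcompD.
exact: Bcomp0.
Qed.

Lemma Btilde_sum b : b = \sum_(p : flat M * flat M) summand p.1 p.2 (b p).
Proof.
apply: Btilde_eqP => F G; rewrite Bcomp_sum (bigD1 (F, G)) //= summandE !eqxx /=.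
rewrite minor_proj_id ?BcompP // big1 ?addr0 // => -[F' G'] /=.
by rewrite summandE xpair_eqE (eq_sym F') (eq_sym G') => /negPf->.
Qed.

Fact starB_l c : zmod_morphism (fun b => star b c).
Proof.
move=> b b'; apply: Btilde_eqP => F G; rewrite BcompB !ffunE -sumrB.
by apply: eq_bigr => H _; rewrite BcompB mulrBl.
Qed.

Fact mu_additive : zmod_morphism (@mu d E M).
Proof. by move=> b c; apply: endzP => z; rewrite /= starB_l. Qed.

HB.instance Definition _ :=
  GRing.isZmodMorphism.Build (Btilde M) (endz (Btilde M)) (@mu d E M) mu_additive.

Fact kappa_additive : zmod_morphism (@kappa d E M).
Proof.
move=> b c; symmetry; apply: adjoint_unique => y z /=.
rewrite raddfB /= -!adjointP starB_l formC raddfB /=.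
by rewrite ![form z _]formC.
Qed.

HB.instance Definition _ :=
  GRing.isZmodMorphism.Build (Btilde M) (endz (Btilde M)) (@kappa d E M) kappa_additive.

Lemma muM b c : mu b * mu c = mu (star b c).
Proof.
apply: endzP => z; apply: Btilde_eqP => F H /=; rewrite !ffunE /=.
under eq_bigr do rewrite ffunE mulr_sumr.
under [RHS]eq_bigr do rewrite ffunE mulr_suml.
rewrite exchange_big; apply: eq_bigr => G _; apply: eq_bigr => G' _.
by rewrite mulrA.
Qed.

Lemma form_kappal b c z : form (kappa b c) z = form c (mu b z).
Proof. by rewrite formC -adjointP formC. Qed.

Lemma kappaM b c : kappa b * kappa c = kappa (star c b).
Proof.
by apply: adjoint_unique => y z; rewrite -muM /= -!adjointP.
Qed.

Lemma mu_summandE G H u z F H' : u \in Bmod G H ->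
  mu (summand G H u) z (F, H') = if H' == H then u * z (F, G) else 0.
Proof.
move=> uB; rewrite ffunE /=; case: eqP => [->|/eqP/negPf neH].
  rewrite (bigD1 G) //= summandE !eqxx minor_proj_id //.
  by rewrite big1 ?addr0 // => K /negPf neK; rewrite summandE neK mul0r.
by rewrite big1 // => K _; rewrite summandE neH andbF mul0r.
Qed.

Lemma star_summand F G H u v : u \in Bmod G H -> v \in Bmod F G ->
  star (summand G H u) (summand F G v) = summand F H (u * v).
Proof.
move=> uB vB; apply: Btilde_eqP => F' H'; rewrite -[star _ _]/(mu _ _).
rewrite mu_summandE // !summandE !minor_proj_id ?(BmodM uB vB) //.
by case: eqP; case: eqP; rewrite ?eqxx ?mulr0.
Qed.

Lemma star_summand0 F G G' H u v : u \in Bmod G H -> G != G' ->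
  star (summand G H u) (summand F G' v) = 0.
Proof.
move=> uB /negPf neG; apply: Btilde_eqP => F' H'; rewrite -[star _ _]/(mu _ _).
by rewrite mu_summandE // !summandE neG andbF mulr0 if_same Bcomp0.
Qed.

Lemma form_ip y z : form y z = \sum_F \sum_G ip (y (F, G)) (z (F, G)).
Proof. by rewrite pair_big; apply: eq_bigr => -[F G]. Qed.

Lemma form_mu G H u y z : u \in Bmod G H ->
  form (mu (summand G H u) y) z = \sum_F ip (u * y (F, G)) (z (F, H)).
Proof.
move=> uB; rewrite form_ip; apply: eq_bigr => F _; rewrite (bigD1 H) //=.
rewrite mu_summandE // eqxx big1 ?addr0 // => H' /negPf neH.
by rewrite mu_summandE // neH ipC raddf0.
Qed.

(** A coefficient of [kappa] is a pairing with a monomial, so adjointness turns it into a pairing of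
    [z] with a product. *)
Lemma kappa_summandE G H u z F G' B : u \in Bmod G H ->
  kappa (summand G H u) z (F, G') B =
  if (G' == G) && minor_basis M (val F) (val G) B then ip (u * mono B) (z (F, H)) else 0.
Proof.
move=> uB; case: (boolP (minor_basis M (val F) (val G') B)) => [bB|NB]; last first.
  have /BmodP -> // := BcompP (kappa (summand G H u) z) F G'.
  by case: eqP => [<-|] //=; rewrite (negPf NB).
have -> : kappa (summand G H u) z (F, G') B =
    form (kappa (summand G H u) z) (Bvec (exist _ (F, G', B) bB)).
  by rewrite form_Bvec.
rewrite form_kappal formC form_mu // (bigD1 F) //= big1 ?addr0.
  rewrite ffunE xpair_eqE eqxx /= (eq_sym G); case: eqP => [<-|_]; first by rewrite bB.
  by rewrite mulr0 ipC raddf0.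
by move=> F' /negPf neF; rewrite ffunE xpair_eqE neF mulr0 ipC raddf0.
Qed.

Definition cover_sum K L : ext E := gsum (val L :\: val K).

Lemma cover_sum_in K L : covers K L -> cover_sum K L \in Bmod K L.
Proof.
move=> cKL; apply: rpred_sum => s sKL; apply/BmodP=> B NB; rewrite ffunE.
by case: eqP => // eB; rewrite eB minor_basis_cover in NB.
Qed.

Lemma mono_in F G B : minor_basis M (val F) (val G) B -> mono B \in Bmod F G.
Proof.
by move=> bB; apply/BmodP=> C NC; rewrite ffunE; case: eqP => // eC; rewrite eC bB in NC.
Qed.

Lemma one_in F : 1 \in Bmod F F.
Proof. by apply: (@mono_in F F set0); rewrite minor_basis0. Qed.

Lemma cover_sum_split L X K : covers L X -> covers X K ->
  gsum (val K :\: val L) = cover_sum L X + cover_sum X K.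
Proof.
move=> /covers_sub sLX /covers_sub sXK; rewrite (@gsumD _ _ (val X :\: val L)) ?setSD //.
congr (_ + gsum _); apply/setP=> s; rewrite !inE; have := subsetP sLX s.
by case: (s \in val L) => [/(_ isT) ->|_]; rewrite ?andbF.
Qed.

(** With [g] the sum of K \ L, the splitting of [g] at [X] and the vanishing of squares turn each
    term into [g * cover_sum L X]. The sets X \ L partition K \ L, so the total is [g * g = 0]. *)
Lemma cover_sum_FS L K : val L \proper val K -> rk M (val K) = (rk M (val L)).+2 ->
  \sum_(X : flat M | covers L X && covers X K) cover_sum X K * cover_sum L X = 0.
Proof.
move=> /proper_sub sLK rK; pose g := gsum (val K :\: val L).
transitivity (\sum_(X : flat M | covers L X && covers X K) g * cover_sum L X).
  apply: eq_bigr => X /andP[cLX cXK].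
  by rewrite /g (cover_sum_split cLX cXK) mulrDl gsum_sqr add0r.
rewrite -mulr_sumr (_ : \sum_(X | _) _ = g) ?gsum_sqr //.
rewrite /cover_sum /gsum (exchange_big_dep (mem (val K :\: val L))) /=; last first.
  move=> X s /andP[_ /covers_sub sXK]; rewrite !inE => /andP[-> sX] /=.
  exact: (subsetP sXK).
(* The only [X] containing a given [s] is the closure of [L] with [s] added. *)
apply: eq_bigr => s; rewrite inE => /andP[sL sK]; rewrite (bigD1 (fcl M (s |: val L))) /=.
  rewrite big1 ?addr0 // => X /andP[/andP[/andP[cLX _]]]; rewrite inE => /andP[_ sX].
  by rewrite -(covers_fcl cLX sX sL) eqxx.
rewrite covers_fclU1 // inE sL mem_fclU1 !andbT; apply/coversP; split.
  by rewrite fcl_min subUset sub1set sK.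
by rewrite rk_fclU1.
Qed.

End Operators.

(** * The wedge relation *)

Section WedgeRelation.
Context {d : Order.disp_t} {E : finOrderType d} (M : matroid E).
Implicit Types (F G H K L X : flat M) (A B S T : {set E}) (u v x z : ext E) (s t : E).

(** The closure of F and [B] lies in both flats and has rank one less than [K]. As [K] is not inside
    [K'], the intersection has no larger rank, so the two agree. Thus a monomial obtained by
    contraction from both [K] and [K'] forces the pair to be modular. *)
Lemma minor_basis_flatI F K K' B s t :
    rk M (val K) = rk M (val K') -> K != K' -> s \notin B ->
    minor_basis M (val F) (val K) (s |: B) ->
    minor_basis M (val F) (val K') (t |: B) ->
  covers (flatI K K') K /\ minor_basis M (val F) (val (flatI K K')) B.
Proof.
move=> eqr neK sB bK bK'; have [cXK _ bX] := minor_basisD1 sB bK.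
suff -> : flatI K K' = fcl M (val F :|: B) by [].
symmetry; apply: flat_rk_eq.
  rewrite fcl_min /= subsetI; case/and4P: bK => sFK + _ _; case/and4P: bK' => sFK' + _ _.
  rewrite !subsetD !subUset sFK sFK' => /andP[/andP[_ ->] _] /andP[/andP[_ ->] _].
  by [].
rewrite -ltnS -(covers_rk cXK); apply: rk_lt; rewrite properE subsetIl /=.
apply: contra neK => sKI; apply/eqP/flat_rk_eq; last by rewrite eqr.
exact: subset_trans sKI (subsetIr _ _).
Qed.

Definition contr_sum A x : ext E := \sum_(s in A) contr s x.

Lemma ip_gsum A x z : ip (gsum A * x) z = ip x (contr_sum A z).
Proof.
rewrite /gsum mulr_suml ip_suml raddf_sum.
by apply: eq_bigr => s _; rewrite ip_gen_mul.
Qed.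

Lemma ext_sumE I (r : seq I) (P : pred I) (f : I -> ext E) B :
  (\sum_(i <- r | P i) f i) B = \sum_(i <- r | P i) f i B.
Proof. by rewrite sum_ffunE. Qed.

Lemma contr_sum_neq0 F K A x B : x \in Bmod F K -> contr_sum A x B != 0 ->
  exists s, [/\ s \in A, s \notin B & minor_basis M (val F) (val K) (s |: B)].
Proof.
move=> /BmodP xK nz; apply: contrapT => no_s; case/negP: nz; apply/eqP.
rewrite ext_sumE big1 // => s sA; rewrite contrE; case: ifP => // /negbT sB.
rewrite xK ?mulr0 //; apply/negP => bB; apply: no_s; by exists s.
Qed.

Lemma contr_out F K s x : x \in Bmod F K -> s \notin val K -> contr s x = 0.
Proof.
move=> /BmodP xK sK; apply/ffunP=> B; rewrite contrE [RHS]ffunE; case: ifP => // _.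
rewrite xK ?mulr0 //; apply: contra sK => /and4P[_ sBK _ _].
by have := subsetP sBK s; rewrite setU11 inE => /(_ isT)/andP[].
Qed.

Lemma ip_Bmod_neq F K K' x z : x \in Bmod F K -> z \in Bmod F K' -> K != K' -> ip x z = 0.
Proof.
move=> /BmodP xK /BmodP zK' neK; apply: big1 => B _.
case: (boolP (minor_basis M (val F) (val K) B)) => [bK|/xK->]; last by rewrite mul0r.
rewrite zK' ?mulr0 //; apply: contra neK => /minor_basis_fcl ->.
by rewrite (minor_basis_fcl bK).
Qed.

Lemma ip_gsum_gsum A A' x z : ip (gsum A * x) (gsum A' * z) =
  \sum_(s in A) \sum_(t in A') ((if s == t then ip x z else 0) - ip (contr t x) (contr s z)).
Proof.
rewrite /gsum !mulr_suml ip_suml; apply: eq_bigr => s _.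
by rewrite raddf_sum; apply: eq_bigr => t _; apply: ip_gen_gen.
Qed.

(** Every [s] in L \ K lies outside [K], so [contr s z = 0]. Only the diagonal terms remain, one for
    each element of L \ K. *)
Lemma ip_cover_same F K L x z : x \in Bmod F K -> z \in Bmod F K ->
  ip (cover_sum K L * x) (cover_sum K L * z) = ip x z *+ #|val L :\: val K|.
Proof.
move=> xK zK; rewrite ip_gsum_gsum -sumr_const; apply: eq_bigr => s sA.
rewrite (bigD1 s) //= eqxx big1 ?addr0 => [|t /andP[_ /negPf]]; last first.
  rewrite eq_sym => ->; rewrite (contr_out zK) ?raddf0 ?subr0 //.
  by move: sA; rewrite inE => /andP[].
by rewrite (contr_out zK) ?raddf0 ?subr0 //; move: sA; rewrite inE => /andP[].
Qed.

(** Contraction by an element outside [K'] kills [x], so only the elements of L \ K that lie in [K']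
    count. *)
Lemma contr_sum_cover F K K' L x : covers K' L -> x \in Bmod F K' ->
  contr_sum (val L :\: val K) x = contr_sum (val K' :\: val (flatI K K')) x.
Proof.
move=> /covers_sub sK'L xK'; rewrite /contr_sum.
rewrite (bigID (mem (val K'))) /= [X in _ + X]big1 ?addr0; last first.
  by move=> s /andP[_]; apply: contr_out xK'.
apply: eq_bigl => s; rewrite !inE; have := subsetP sK'L s.
by case: (s \in val K') => [/(_ isT) ->|_]; rewrite ?andbF ?andbT.
Qed.

Lemma ip_contr_sum A A' x z : ip (contr_sum A x) (contr_sum A' z) =
  \sum_(s in A') \sum_(t in A) ip (contr t x) (contr s z).
Proof. by rewrite [X in ip _ X]/contr_sum raddf_sum; apply: eq_bigr => s _; apply: ip_suml. Qed.

(** The diagonal terms vanish because [x] and [z] involve bases spanning different flats; only the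
    contraction terms are left. *)
Lemma ip_cover_neq F K K' L x z : covers K L -> covers K' L -> K != K' ->
    x \in Bmod F K' -> z \in Bmod F K ->
  ip (cover_sum K' L * x) (cover_sum K L * z) =
  - ip (contr_sum (val K' :\: val (flatI K K')) x)
       (contr_sum (val K :\: val (flatI K K')) z).
Proof.
move=> cK cK' neK xK' zK; rewrite -(contr_sum_cover _ cK' xK').
have -> : val K :\: val (flatI K K') = val K :\: val (flatI K' K) by rewrite /= setIC.
rewrite -(contr_sum_cover _ cK zK) ip_gsum_gsum ip_contr_sum -sumrN.
apply: eq_bigr => s _; rewrite -sumrN; apply: eq_bigr => t _.
by rewrite (ip_Bmod_neq xK' zK) 1?eq_sym // if_same sub0r.
Qed.

Lemma ip_contr_sum_nonmodular F K K' L A A' x z : covers K L -> covers K' L ->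
    K != K' -> ~~ covers (flatI K K') K -> x \in Bmod F K' -> z \in Bmod F K ->
  ip (contr_sum A x) (contr_sum A' z) = 0.
Proof.
move=> cK cK' neK NcI xK' zK; apply: big1 => B _.
have [->|/(contr_sum_neq0 xK')[t [_ tB bt]]] := eqVneq (contr_sum A x B) 0.
  by rewrite mul0r.
have [->|/(contr_sum_neq0 zK)[s [_ sB bs]]] := eqVneq (contr_sum A' z B) 0.
  by rewrite mulr0.
have eqr : rk M (val K) = rk M (val K') by apply: succn_inj; rewrite -!(covers_rk (L := L)).
by case: (minor_basis_flatI eqr neK sB bs bt) => cI; rewrite cI in NcI.
Qed.

(** A monomial occurring in both contractions is a basis at the intersection, by
    [minor_basis_flatI]. The projection is therefore harmless, and it is the one that [kappa]
    performs in [kappa_cover]. *)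
Lemma ip_contr_sum_modular F K K' L A A' x z : covers K L -> covers K' L ->
    K != K' -> x \in Bmod F K' -> z \in Bmod F K ->
  ip (contr_sum A x) (contr_sum A' z) =
  ip (minor_proj F (flatI K K') (contr_sum A x)) (contr_sum A' z).
Proof.
move=> cK cK' neK xK' zK; apply: eq_bigr => B _; rewrite minor_projE.
case: ifP => // NbB; apply/eqP; rewrite mul0r mulf_eq0 -implyNb; apply/implyP.
case/(contr_sum_neq0 xK')=> t [_ tB bt]; apply/negP => /negP.
case/(contr_sum_neq0 zK)=> s [_ sB bs].
have eqr : rk M (val K) = rk M (val K') by apply: succn_inj; rewrite -!(covers_rk (L := L)).
by case: (minor_basis_flatI eqr neK sB bs bt) => _; rewrite NbB.
Qed.

End WedgeRelation.

(** * The defining relations of S(M) as operator identities *)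

Section Representation.
Context {d : Order.disp_t} {E : finOrderType d} (M : matroid E).
Implicit Types (F G H K L X : flat M) (A B S T : {set E}) (u v x : ext E) (s t : seq (flat M)).
Implicit Types (b c y z : Btilde M).

Definition up_op K L : endz (Btilde M) := kappa (summand K L (cover_sum K L)).
Definition down_op K L : endz (Btilde M) := mu (summand K L (cover_sum K L)).

Lemma endz_form_eq (f g : endz (Btilde M)) :
  (forall y z, form (f y) z = form (g y) z) -> f = g.
Proof. by move=> fg; apply: endzP => y; apply: form_eqP => t; apply: fg. Qed.

Lemma form_up_down K K' L y z : covers K L -> covers K' L ->
  form ((up_op K L * down_op K' L) y) z =
  \sum_F ip (cover_sum K' L * y (F, K')) (cover_sum K L * z (F, K)).
Proof.
move=> cK cK'; rewrite /= form_kappal form_mu ?cover_sum_in //.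
by apply: eq_bigr => F _; rewrite mu_summandE ?cover_sum_in // eqxx.
Qed.

Lemma kappa_cover K L z F : covers K L ->
  up_op K L z (F, K) = minor_proj F K (contr_sum (val L :\: val K) (z (F, L))).
Proof.
move=> cKL; apply/ffunP=> B; rewrite kappa_summandE ?cover_sum_in // eqxx minor_projE /=.
by case: ifP => // _; rewrite ip_gsum ipC ip_mono.
Qed.

Lemma form_down_up K K' I y z : covers I K -> covers I K' ->
  form ((down_op I K * up_op I K') y) z =
  \sum_F ip (minor_proj F I (contr_sum (val K' :\: val I) (y (F, K'))))
            (contr_sum (val K :\: val I) (z (F, K))).
Proof.
move=> cK cK'; rewrite /= form_mu ?cover_sum_in //; apply: eq_bigr => F _.
by rewrite ip_gsum -kappa_cover.
Qed.

Lemma endz_mulrnE (f : endz (Btilde M)) n y : (f *+ n) y = f y *+ n.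
Proof. by elim: n => // n IH; rewrite !mulrS /= IH. Qed.

Lemma endz_opprE (f : endz (Btilde M)) y : (- f) y = - f y.
Proof. by []. Qed.

Lemma form_proj K y z : form (mu (summand K K 1) y) z = \sum_F ip (y (F, K)) (z (F, K)).
Proof. by rewrite form_mu ?one_in //; apply: eq_bigr => F _; rewrite mul1r. Qed.

Lemma up_down_same K L : covers K L ->
  up_op K L * down_op K L = mu (summand K K 1) *+ #|val L :\: val K|.
Proof.
move=> cK; apply: endz_form_eq => y z; rewrite form_up_down // endz_mulrnE.
rewrite [RHS](formC _ z) raddfMn /= formC form_proj -sumrMnl; apply: eq_bigr => F _.
by apply: ip_cover_same; apply: BcompP.
Qed.

Lemma up_down_modular K K' L : covers K L -> covers K' L -> K != K' ->
    covers (flatI K K') K ->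
  up_op K L * down_op K' L = - (down_op (flatI K K') K * up_op (flatI K K') K').
Proof.
move=> cK cK' neK cI; have cI' := covers_flatI cK cK' cI.
apply: endz_form_eq => y z; rewrite form_up_down //.
rewrite endz_opprE [RHS](formC _ z) raddfN /= formC form_down_up // -sumrN.
apply: eq_bigr => F _; rewrite (ip_cover_neq (F := F) cK cK' neK) ?BcompP //; congr (- _).
by apply: (ip_contr_sum_modular _ _ cK cK' neK); apply: BcompP.
Qed.

Lemma up_down_nonmodular K K' L : covers K L -> covers K' L -> K != K' ->
  ~~ covers (flatI K K') K -> up_op K L * down_op K' L = 0.
Proof.
move=> cK cK' neK NcI; apply: endz_form_eq => y z; rewrite form_up_down //.
rewrite [RHS](formC 0 z) raddf0 big1 // => F _.
rewrite (ip_cover_neq (F := F) cK cK' neK) ?BcompP //.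
by rewrite (ip_contr_sum_nonmodular _ _ (F := F) cK cK' neK NcI) ?BcompP // oppr0.
Qed.

Lemma down_FS L K : val L \proper val K -> rk M (val K) = (rk M (val L)).+2 ->
  \sum_(X : flat M | covers L X && covers X K) down_op X K * down_op L X = 0.
Proof.
move=> pLK rK; transitivity (mu (summand L K
    (\sum_(X : flat M | covers L X && covers X K) cover_sum X K * cover_sum L X))).
  rewrite !raddf_sum; apply: eq_bigr => X /andP[cL cK].
  by rewrite /= muM star_summand ?cover_sum_in.
by rewrite cover_sum_FS // !raddf0.
Qed.

Lemma up_FS L K : val L \proper val K -> rk M (val K) = (rk M (val L)).+2 ->
  \sum_(X : flat M | covers L X && covers X K) up_op L X * up_op X K = 0.
Proof.
move=> pLK rK; transitivity (kappa (summand L K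
    (\sum_(X : flat M | covers L X && covers X K) cover_sum X K * cover_sum L X))).
  rewrite !raddf_sum; apply: eq_bigr => X /andP[cL cK].
  by rewrite /= kappaM star_summand ?cover_sum_in.
by rewrite cover_sum_FS // !raddf0.
Qed.

End Representation.

(** * The representation of S(M) *)

Lemma endz_sumE (V : zmodType) I (r : seq I) (P : pred I) (f : I -> endz V) z :
  (\sum_(i <- r | P i) f i : endz V) z = \sum_(i <- r | P i) f i z.
Proof. exact: (big_morph (fun f : endz V => f z)). Qed.

Section PathRepresentation.
Context {d : Order.disp_t} {E : finOrderType d} (M : matroid E).
Implicit Types (F G H K L X : flat M) (s t : seq (flat M)) (a b : path_alg M).

Definition vertex_op K : endz (Btilde M) := mu (summand K K 1).

Definition step_op K L : endz (Btilde M) :=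
  if covers K L then up_op K L else if covers L K then down_op L K else 0.

Fixpoint path_op K s : endz (Btilde M) :=
  if s is L :: t then step_op K L * path_op L t else vertex_op K.

Lemma covers_asym K L : covers K L -> covers L K = false.
Proof.
move=> /covers_rk rL; apply/negP => /covers_rk rK.
by move: rK; rewrite rL => /eqP; rewrite -[X in X == _]addn0 -addn2 eqn_add2l.
Qed.

Lemma step_op_up K L : covers K L -> step_op K L = up_op K L.
Proof. by rewrite /step_op => ->. Qed.

Lemma step_op_down K L : covers L K -> step_op K L = down_op L K.
Proof. by move=> cLK; rewrite /step_op cLK covers_asym. Qed.

Lemma mu_summandM F G H u v : u \in Bmod G H -> v \in Bmod F G ->
  mu (summand G H u) * mu (summand F G v) = mu (summand F H (u * v)).
Proof. by move=> uB vB; rewrite muM star_summand. Qed.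

Lemma kappa_summandM F G H u v : u \in Bmod F G -> v \in Bmod G H ->
  kappa (summand F G u) * kappa (summand G H v) = kappa (summand F H (v * u)).
Proof. by move=> uB vB; rewrite kappaM star_summand. Qed.

Lemma vertex_opE K z F G : vertex_op K z (F, G) = if G == K then z (F, G) else 0.
Proof. by rewrite mu_summandE ?one_in // mul1r; case: eqP => // ->. Qed.

Lemma vertex_op_kappa K : vertex_op K = kappa (summand K K 1).
Proof.
apply: endz_form_eq => y z; rewrite form_kappal [RHS]formC /vertex_op !form_proj.
by apply: eq_bigr => F _; rewrite ipC.
Qed.

Lemma vertex_opM K L : vertex_op K * vertex_op L = if K == L then vertex_op K else 0.
Proof.
case: eqP => [<-|/eqP neK]; first by rewrite mu_summandM ?one_in // mul1r.
by rewrite muM star_summand0 ?one_in // raddf0.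
Qed.

Lemma vertex_step K L : vertex_op K * step_op K L = step_op K L.
Proof.
rewrite /step_op; case: ifP => [cKL|_].
  by rewrite vertex_op_kappa kappa_summandM ?one_in ?cover_sum_in // mulr1.
case: ifP => [cLK|_]; last by rewrite mulr0.
by rewrite mu_summandM ?one_in ?cover_sum_in // mul1r.
Qed.

Lemma step_vertex K L : step_op K L * vertex_op L = step_op K L.
Proof.
rewrite /step_op; case: ifP => [cKL|_].
  by rewrite vertex_op_kappa kappa_summandM ?one_in ?cover_sum_in // mul1r.
case: ifP => [cLK|_]; last by rewrite mul0r.
by rewrite mu_summandM ?one_in ?cover_sum_in // mulr1.
Qed.

Lemma vertex_path K s : vertex_op K * path_op K s = path_op K s.
Proof.
by case: s => [|L s] /=; [rewrite vertex_opM eqxx | rewrite mulrA vertex_step].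
Qed.

Lemma path_vertex K s : path_op K s * vertex_op (last K s) = path_op K s.
Proof.
elim: s K => [|L s IH] K /=; first by rewrite vertex_opM eqxx.
by rewrite -mulrA IH.
Qed.

Lemma path_op_cat K s t : path_op K (s ++ t) = path_op K s * path_op (last K s) t.
Proof.
elim: s K => [|L s IH] K /=; first by rewrite vertex_path.
by rewrite IH mulrA.
Qed.

Lemma path_opM K s L t :
  path_op K s * path_op L t = if last K s == L then path_op K (s ++ t) else 0.
Proof.
case: eqP => [<-|/eqP/negPf neL]; first by rewrite path_op_cat.
by rewrite -path_vertex -(vertex_path L) -mulrA (mulrA (vertex_op _)) vertex_opM neL mul0r mulr0.
Qed.

(** Agrees with the default value 0 of [fpath], so that [path_rep_fpath] holds for arbitrary
    lists. *)
Lemma path_op_nonpath K s : ~~ path (@adjacent E M) K s -> path_op K s = 0.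
Proof.
elim: s K => //= L s IH K; rewrite negb_and => /orP[|/IH->]; last by rewrite mulr0.
by rewrite /adjacent negb_or /step_op => /andP[/negPf-> /negPf->]; rewrite mul0r.
Qed.

(** The alias [zmodule] supplies the [int]-module structure over which [fglift] extends linearly. *)
Definition path_rep a : endz (Btilde M) :=
  fglift (fun p : flag_path M => path_op (val p).1 (val p).2 : zmodule (endz (Btilde M))) a.

Fact path_rep_additive : zmod_morphism path_rep.
Proof.
exact: (@lift_is_additive int (flag_path M) (zmodule (endz (Btilde M)))).
Qed.

HB.instance Definition _ := GRing.isZmodMorphism.Build (path_alg M) (endz (Btilde M))
  path_rep path_rep_additive.

Lemma path_repU p : path_rep << p >> = path_op (val p).1 (val p).2.
Proof. by rewrite /path_rep liftU scale1r. Qed.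

Lemma path_rep_fpath K s : path_rep (fpath K s) = path_op K s.
Proof.
rewrite /fpath; case: insubP => [p _ ep|/path_op_nonpath -> //]; last exact: raddf0.
by rewrite path_repU ep.
Qed.

Fact path_rep_monoid : monoid_morphism path_rep.
Proof.
split=> [|a b].
  rewrite [1]/(path_one M) raddf_sum; apply: endzP => z; apply: Btilde_eqP => F G.
  rewrite endz_sumE Bcomp_sum (bigD1 G) //= path_rep_fpath vertex_opE eqxx.
  rewrite big1 ?addr0 // => K /negPf neK.
  by rewrite path_rep_fpath vertex_opE eq_sym neK.
apply: (path_alg_morph_eq (f := fun a => path_rep (a * b))
   (g := fun a => path_rep a * path_rep b)) a => [x y|x y|p].
- by rewrite mulrBl raddfB.
- by rewrite raddfB mulrBl.
apply: (path_alg_morph_eq (f := fun b => path_rep ((<< p >> : path_alg M) * b))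
   (g := fun b => path_rep << p >> * path_rep b)) b => [x y|x y|q].
- by rewrite mulrBr raddfB.
- by rewrite raddfB mulrBr.
rewrite -[_ * _ in LHS]/(path_mul << p >> << q >>) path_mulE !path_repU path_opM.
case: pcatP => [/negPf->|r -> er]; first exact: raddf0.
by rewrite eqxx path_repU er.
Qed.

HB.instance Definition _ := GRing.isMonoidMorphism.Build (path_alg M) (endz (Btilde M))
  path_rep path_rep_monoid.

Lemma path_op2 K L X : path_op K [:: L; X] = step_op K L * step_op L X.
Proof. by rewrite /= step_vertex. Qed.

Lemma path_rep_relator a : relator a -> path_rep a = 0.
Proof.
case=> [L K pLK rK|L K pLK rK|K L cKL|K K' L cK cK' neK cI|K K' L cK cK' neK NcI].
- rewrite raddf_sum; apply: etrans (up_FS pLK rK); apply: eq_bigr => X /andP[cL cK].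
  by rewrite /= path_rep_fpath path_op2 !step_op_up.
- rewrite raddf_sum; apply: etrans (down_FS pLK rK); apply: eq_bigr => X /andP[cL cK].
  by rewrite /= path_rep_fpath path_op2 !step_op_down.
- rewrite raddfB raddfMn /= !path_rep_fpath -[path_op K [::]]/(vertex_op K).
  rewrite path_op2 step_op_up // step_op_down //.
  by rewrite up_down_same // subrr.
- have cI' := covers_flatI cK cK' cI.
  rewrite raddfD /= !path_rep_fpath !path_op2.
  rewrite (step_op_up cK) (step_op_down cK') (step_op_down cI) (step_op_up cI').
  by rewrite up_down_modular // addNr.
- by rewrite /= path_rep_fpath path_op2 step_op_up // step_op_down // up_down_nonmodular.
Qed.

Lemma path_rep_ideal a : in_ideal (@relator E M) a -> path_rep a = 0.
Proof.
elim=> [b /path_rep_relator //||b c _ Hb _ Hc|b c _ Hc|b c _ Hc].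
- exact: raddf0.
- by rewrite raddfB /= Hb Hc subrr.
- by rewrite rmorphM /= Hc mulr0.
- by rewrite rmorphM /= Hc mul0r.
Qed.

Local Notation Spi a := (qpi (@relator E M) a : S_alg M).

Lemma S_algM a b : Spi a * Spi b = Spi (a * b).
Proof. exact: qpiM. Qed.

Definition flag_rep (x : S_alg M) : endz (Btilde M) := path_rep (qrepr x).

Lemma flag_rep_qpi a : flag_rep (qpi (@relator E M) a) = path_rep a.
Proof.
apply/eqP; rewrite -subr_eq0 -raddfB; apply/eqP/path_rep_ideal/qpi_eq.
exact: qreprK.
Qed.

Fact flag_rep_additive : zmod_morphism flag_rep.
Proof.
move=> x y; rewrite -[x]qreprK -[y]qreprK -[X in flag_rep X](raddfB (qpi _)).
by rewrite !flag_rep_qpi raddfB.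
Qed.

HB.instance Definition _ := GRing.isZmodMorphism.Build (S_alg M) (endz (Btilde M))
  flag_rep flag_rep_additive.

Fact flag_rep_monoid : monoid_morphism flag_rep.
Proof.
split=> [|x y]; first by rewrite [1]/(qpi _ 1) flag_rep_qpi rmorph1.
by rewrite -[x]qreprK -[y]qreprK S_algM !flag_rep_qpi rmorphM.
Qed.

HB.instance Definition _ := GRing.isMonoidMorphism.Build (S_alg M) (endz (Btilde M))
  flag_rep flag_rep_monoid.

End PathRepresentation.

(** * Flags without broken circuits *)

Lemma in_span_trans (V : zmodType) (G H : V -> Prop) x :
  (forall y, G y -> in_span H y) -> in_span G x -> in_span H x.
Proof. by move=> GH; apply: (in_span_map (f := id)). Qed.

Section BrokenCircuits.
Context {d : Order.disp_t} {E : finOrderType d} (M : matroid E).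
Implicit Types (F G H K L N X Y : flat M) (A B S T : {set E}) (v x y : ext E).
Implicit Types (s t : seq E) (p q : seq (flat M)) (b m : E).

Definition span_flat N s : flat M := fcl M (val N :|: [set z in s]).

(** An nbc flag above [N] is encoded by its least elements, top step first: [b] is least in the top
    flat off [N] and avoids the flat below. The flats are recovered as the values of [span_flat] on
    the tails. *)
Fixpoint nbc N s : bool :=
  if s is b :: s' then
    [&& nbc N s', b \notin val (span_flat N s') &
        [forall z in val (span_flat N s) :\: val N, (b <= z)%O]]
  else true.

Fixpoint nbc_flag N s : seq (flat M) :=
  if s is _ :: s' then span_flat N s :: nbc_flag N s' else [:: N].

Lemma span_flat_nil N : span_flat N [::] = N.
Proof.
by rewrite /span_flat (_ : [set z in [::]] = set0) ?setU0 ?fcl_flat.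
Qed.

Lemma span_flat_cons N b s : span_flat N (b :: s) = fcl M (b |: val (span_flat N s)).
Proof. by rewrite fclU setUCA -set_cons. Qed.

Lemma sub_span_flat N s : val N \subset val (span_flat N s).
Proof. exact: subset_trans (subsetUl _ _) (sub_closure _ _). Qed.

Lemma mem_span_flat N s b : b \in s -> b \in val (span_flat N s).
Proof. by move=> bs; apply: (subsetP (sub_closure _ _)); rewrite !inE bs orbT. Qed.

Lemma nbc_covers N b s : nbc N (b :: s) -> covers (span_flat N s) (span_flat N (b :: s)).
Proof. by case/and3P=> _ bs _; rewrite span_flat_cons; apply: covers_fclU1. Qed.

Lemma nbc_min N b s z : nbc N (b :: s) ->
  z \in val (span_flat N (b :: s)) -> z \notin val N -> (b <= z)%O.
Proof.
case/and3P=> _ _ /forallP/(_ z) + zs zN.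
by rewrite inE zs zN; apply.
Qed.

Lemma nbc_notin N b s : nbc N (b :: s) -> b \notin val N.
Proof. by case/and3P=> _ + _; apply/contra/(subsetP (sub_span_flat N s)). Qed.

Lemma nbc_mem_notin N b s : nbc N s -> b \in s -> b \notin val N.
Proof.
elim: s => // b' s IH nbcs; rewrite inE => /predU1P[->|]; first exact: nbc_notin nbcs.
by case/and3P: nbcs => + _ _; apply: IH.
Qed.

Lemma nbc_flagE N s : nbc_flag N s = span_flat N s :: behead (nbc_flag N s).
Proof. by case: s => //=; rewrite span_flat_nil. Qed.

Definition descending := path (fun K L => covers L K).

Lemma nbc_flag_descending N s : nbc N s ->
  descending (span_flat N s) (behead (nbc_flag N s)) /\
  last (span_flat N s) (behead (nbc_flag N s)) = N.
Proof.
elim: s => [_|b s IH nbcs] /=; first by rewrite span_flat_nil.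
case/and3P: (nbcs) => /IH[]; rewrite /descending nbc_flagE /= => -> -> _ _.
by rewrite nbc_covers.
Qed.

Lemma exists_min A : A != set0 -> exists2 m, m \in A & forall z, z \in A -> (m <= z)%O.
Proof. by case/set0Pn=> z0 z0A; case: (arg_minP id z0A) => m mA min_m; exists m. Qed.

Lemma nbc_cons N K s m : nbc N s -> covers (span_flat N s) K ->
    m \in val K -> m \notin val (span_flat N s) ->
    (forall z, z \in val K :\: val N -> (m <= z)%O) ->
  nbc N (m :: s) /\ span_flat N (m :: s) = K.
Proof.
move=> nbcs cK mK ms min_m; have eK : span_flat N (m :: s) = K.
  by rewrite span_flat_cons (covers_fcl cK mK ms).
split=> //; apply/and3P; split=> //.
by rewrite eK; apply/forallP => z; apply/implyP; apply: min_m.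
Qed.

(* Flags modulo (FS), with [f] an arbitrary realization: if the least element m
   of K \ N already enters the flag below the top step, (FS) at the flat where
   it enters moves it one step up. *)
Lemma nbc_flag_span (V : zmodType) (f : seq (flat M) -> V) :
    (forall q K L p, val L \proper val K -> rk M (val K) = (rk M (val L)).+2 ->
      \sum_(X : flat M | covers L X && covers X K) f (q ++ [:: K, X, L & p]) = 0) ->
  forall K p q, descending K p ->
  in_span (fun v : V => exists2 s, nbc (last K p) s && (span_flat (last K p) s == K)
                      & v = f (q ++ nbc_flag (last K p) s)) (f (q ++ K :: p)).
Proof.
move=> FS K; elim: {K}_.+1 {-2}K (ltnSn (rk M (val K))) => // n IH K leK [|X p] q /=.
  by move=> _; apply: in_span_gen; exists [::]; rewrite ?span_flat_nil ?eqxx.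
case/andP=> cXK dXp; set N := last X p.
have ltX Y : covers Y K -> (rk M (val Y) < n)%N.
  by move=> /covers_rk rK; rewrite rK in leK.
have := IH X (ltX X cXK) p (rcons q K) dXp; rewrite cat_rcons -/N.
apply: in_span_trans => _ [s /andP[nbcs /eqP eX] ->]; rewrite cat_rcons -{}eX in cXK *.
have [|m] := @exists_min (val K :\: val N).
  apply/set0Pn; have /properP[_ [z zK zN]] : val N \proper val K; last first.
    by exists z; rewrite inE zK zN.
  have := cXK; rewrite coversE => /andP[pXK _].
  exact: sub_proper_trans (sub_span_flat N s) pXK.
rewrite inE => /andP[mN mK] min_m.
have done_top t : nbc N t -> covers (span_flat N t) K -> m \notin val (span_flat N t) ->
    in_span (fun v : V => exists2 s0, nbc N s0 && (span_flat N s0 == K)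
      & v = f (q ++ nbc_flag N s0)) (f (q ++ K :: nbc_flag N t)).
  move=> nbct cK mt; have [nbcm eK] := nbc_cons nbct cK mK mt min_m.
  apply: in_span_gen; exists (m :: t); first by rewrite nbcm eK eqxx.
  by rewrite /= eK.
have [ms|/done_top] := boolP (m \in val (span_flat N s)); last exact.
case: s nbcs cXK ms => [|b s] nbcs cXK ms.
  by rewrite span_flat_nil (negPf mN) in ms.
(* Both are least: [b] off [N] in a flat containing [m], and [m] in K \ N, which contains [b]. So
   [m] enters exactly at the top step of this flag. *)
have eb : b = m.
  apply/le_anti; rewrite (nbc_min nbcs) //=; apply: min_m.
  rewrite inE (nbc_notin nbcs) (subsetP (covers_sub cXK)) //.
  by rewrite mem_span_flat ?mem_head.
move: nbcs cXK ms; rewrite {}eb => nbcs cXK ms.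
have cY := nbc_covers nbcs; set Y := span_flat N s in cY.
set X0 := span_flat N (m :: s) in cXK cY ms.
have mY : m \notin val Y by case/and3P: nbcs.
have nbcs' : nbc N s by case/and3P: nbcs.
have pYK : val Y \proper val K.
  have := cXK; have := cY; rewrite !coversE => /andP[pY _] /andP[pX _].
  exact: proper_trans pY pX.
have rK : rk M (val K) = (rk M (val Y)).+2 by rewrite (covers_rk cXK) (covers_rk cY).
(* (FS) between [Y] and [K] replaces [X0] by the other intermediate flats. None contains [m], since
   [X0] is the closure of [Y] with [m]; straightening below them therefore ends in the case
   [done_top]. *)
have := FS q K Y (behead (nbc_flag N s)) pYK rK.
rewrite (bigD1 X0) ?cY ?cXK //= -/X0 -nbc_flagE => /eqP; rewrite addr_eq0 => /eqP->.
apply/in_spanN/in_span_sum => X' /andP[/andP[cYX' cX'K] neX'].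
have mX' : m \notin val X'.
  apply: contra neX' => mX'; apply/eqP.
  by rewrite (covers_fcl cYX' mX' mY) -(covers_fcl cY ms mY).
have [dY lY] := nbc_flag_descending nbcs'.
have := IH X' (ltX X' cX'K) (nbc_flag N s) (rcons q K).
rewrite nbc_flagE /descending /= cYX' lY cat_rcons => /(_ dY).
apply: in_span_trans => _ [t /andP[nbct /eqP et] ->]; rewrite cat_rcons.
by apply: done_top; rewrite ?et.
Qed.

Fixpoint nbc_vec N s : ext E :=
  if s is b :: s' then cover_sum (span_flat N s') (span_flat N s) * nbc_vec N s' else 1.

Lemma nbc_vec_in N s : nbc N s -> nbc_vec N s \in Bmod N (span_flat N s).
Proof.
elim: s => [_|b s IH nbcs] /=; first by rewrite span_flat_nil one_in.
by apply: BmodM (cover_sum_in (nbc_covers nbcs)) (IH _); case/and3P: nbcs.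
Qed.

Lemma nbc_basis N s : nbc N s -> minor_basis M (val N) (val (span_flat N s)) [set z in s].
Proof.
elim: s => [_|b s IH nbcs].
  by rewrite span_flat_nil (_ : [set z in [::]] = set0) ?minor_basis0.
rewrite set_cons; case/and3P: (nbcs) => /IH bs bY _; apply: minor_basisU bs _.
by apply: minor_basis_cover (nbc_covers nbcs) _; rewrite inE bY mem_span_flat ?mem_head.
Qed.

(** Only the generator [m] contributes: any other would leave a monomial of [v] containing [m],
    which is outside [Y]. The sign is 1 because [m] precedes all of [S]. *)
Lemma cover_sum_mul_min N K Y v S m : v \in Bmod N Y -> m \in val K -> m \notin val Y ->
    m \notin S -> (forall z, z \in S -> (m <= z)%O) ->
  (cover_sum Y K * v) (m |: S) = v S.
Proof.
move=> /BmodP vY mK mY mS min_m; rewrite mulr_suml ext_sumE (bigD1 m) ?inE ?mK ?mY //=.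
rewrite gen_mulE setU11 setU1K // /shuffle_sign eq_card0 ?mul1r => [|z]; last first.
  rewrite !inE; apply/negP => /and3P[/eqP-> /min_m le_m lt_m].
  by have := le_lt_trans le_m lt_m; rewrite ltxx.
rewrite big1 ?addr0 // => t /andP[_ neqt]; rewrite gen_mulE; case: ifP => // _.
rewrite vY ?mulr0 //; apply: contra mY => /and4P[_ /subsetP/(_ m) + _ _].
by rewrite !inE eqxx eq_sym neqt /= => /(_ isT)/andP[].
Qed.

(** A common top flat forces a common first element, its least element off [N], which
    [cover_sum_mul_min] strips off. If the next flats differ, the remaining monomial spans the wrong
    flat and its coefficient is 0; otherwise induction applies. *)
Lemma nbc_vec_dual N s t : nbc N s -> nbc N t -> span_flat N s = span_flat N t ->
  nbc_vec N s [set z in t] = (s == t)%:R.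
Proof.
have set0E : [set z in [::]] = set0 :> {set E} by [].
elim: s t => [|b s IH] [|c t] nbcs nbct eq_st.
- by rewrite set0E ffunE eqxx.
- have := nbc_notin nbct; rewrite -[in X in _ \notin X](span_flat_nil N) eq_st.
  by rewrite mem_span_flat ?mem_head.
- have := nbc_notin nbcs; rewrite -[in X in _ \notin X](span_flat_nil N) -eq_st.
  by rewrite mem_span_flat ?mem_head.
have ebc : b = c.
  apply/le_anti; rewrite (nbc_min nbcs) ?(nbc_min nbct) ?(nbc_notin nbct) ?(nbc_notin nbcs) //.
    by rewrite -eq_st mem_span_flat ?mem_head.
  by rewrite eq_st mem_span_flat ?mem_head.
move: nbct eq_st; rewrite -{}ebc => nbct eq_st.
case/and3P: (nbcs) (nbct) => nbcs' bs _ /and3P[nbct' bt _].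
rewrite /= set_cons (cover_sum_mul_min (nbc_vec_in nbcs')) //.
- rewrite eqseq_cons eqxx /=; have [eqs|neqs] := eqVneq (span_flat N s) (span_flat N t).
    exact: IH.
  have /BmodP -> := nbc_vec_in nbcs'; first by case: (s =P t) neqs => // ->; rewrite eqxx.
  by apply: contra neqs => /minor_basis_fcl ->.
- by rewrite mem_span_flat ?mem_head.
- by rewrite inE; apply: contra bt => /mem_span_flat; apply.
- move=> z; rewrite inE => zt; apply: (nbc_min nbct); last exact: nbc_mem_notin zt.
  by rewrite mem_span_flat // inE zt orbT.
Qed.

(** A monomial of the product is a basis of M^X_N enlarged by an element of [X], hence still spans
    [X]. Products belonging to different [X] thus share no monomial. *)
Lemma gsum_mul_neq0 N X v T : v \in Bmod N X -> (gsum (val X :\: val N) * v) T != 0 ->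
  fcl M (val N :|: T) = X.
Proof.
move=> /BmodP vX nz; apply/eqP; apply: contraNT nz => neX.
rewrite /gsum mulr_suml ext_sumE big1 // => t; rewrite inE => /andP[_ tX].
rewrite gen_mulE; case: ifP => // tT; rewrite vX ?mulr0 //; apply: contra neX => bT.
have eX := minor_basis_fcl bT; case/and4P: bT => sNX sTX _ _.
rewrite -(setD1K tT) setUCA -fclU -eX (setUidPr _) ?fcl_flat //.
by rewrite sub1set.
Qed.

(* x = u * iota_m x for u the sum of K \ N, where iota_m x splits according to
   the hyperplanes of M^K_N that avoid m. *)
Lemma nbc_vec_span N K x : val N \subset val K -> x \in Bmod N K ->
    gsum (val K :\: val N) * x = 0 ->
  in_span (fun v => exists2 s, nbc N s && (span_flat N s == K) & v = nbc_vec N s) x.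
Proof.
elim: {K}_.+1 {-2}K (ltnSn (rk M (val K))) x => // n IH K leK x sNK xK ux0.
have [eNK|neNK] := eqVneq N K.
  (* For [N = K] the only basis of the minor is the empty set. *)
  have -> : x = 1 *~ x set0.
    apply/ffunP=> B; rewrite ext_coefMz ffunE; case: eqP => [->|/eqP neB]; first by rewrite intz.
    rewrite mul0rz; move/BmodP: xK => -> //; apply: contra neB => bB.
    have := rk_minor_basis bB; rewrite eNK -[LHS]addn0 => /addnI/esym/eqP.
    by rewrite cards_eq0.
  apply: in_spanMz; apply: in_span_gen; exists [::] => //=.
  by rewrite span_flat_nil eNK.
have [|m] := @exists_min (val K :\: val N).
  rewrite setD_eq0; apply: contra neNK => sKN; rewrite -val_eqE eqEsubset sNK.
  exact: sKN.
move=> mKN min_m; have := mKN; rewrite inE => /andP[mN mK].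
set g := gsum _ in ux0; pose y := contr m x.
have ex : x = g * y.
  apply/eqP; rewrite -subr_eq0 /y /g -contr_gsum // -/g ux0; apply/eqP/raddf0.
pose P X := [&& val N \subset val X, covers X K & m \notin val X].
pose yX X := minor_proj N X y.
have yXin X : yX X \in Bmod N X by apply: minor_proj_in.
(* Each monomial of [y] is a basis of M^K_N with [m] removed, so it is a basis of exactly one
   hyperplane, and that one avoids [m]. *)
have ey : y = \sum_(X | P X) yX X.
  apply/ffunP=> S; rewrite ext_sumE; have [yS|yS] := eqVneq (y S) 0.
    by rewrite yS big1 // => X _; rewrite minor_projE yS if_same.
  have [mS bmS] : m \notin S /\ minor_basis M (val N) (val K) (m |: S).
    move: yS; rewrite contrE; case: (m \in S); first by rewrite eqxx.
    move=> nz; split=> //; apply: contraR nz => NbS.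
    by move/BmodP: xK => -> //; rewrite mulr0.
  have [cX mX bX] := minor_basisD1 mS bmS.
  rewrite (bigD1 (fcl M (val N :|: S))) /=; last first.
    by rewrite /P cX mX; case/and4P: bX => ->.
  rewrite minor_projE bX big1 ?addr0 // => X /andP[_ neX]; rewrite minor_projE.
  by case: ifP => // /minor_basis_fcl eX; rewrite -eX eqxx in neX.
have ex' : x = \sum_(X | P X) cover_sum X K * yX X +
               \sum_(X | P X) gsum (val X :\: val N) * yX X.
  rewrite {1}ex ey mulr_sumr -big_split /=; apply: eq_bigr => X /and3P[sNX cXK _].
  rewrite -mulrDl addrC /g; congr (_ * _); rewrite (@gsumD _ _ (val X :\: val N)).
    congr (_ + gsum _); apply/setP=> z; rewrite !inE; have := subsetP sNX z.
    by case: (z \in val N) => [/(_ isT) ->|_]; rewrite ?andbF.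
  by rewrite setSD // covers_sub.
(* A monomial of this product spans [X], so it is not a basis of M^K_N. It occurs neither in [x] nor
   in the first sum of [ex'], and in the second sum only in the term of [X]; its coefficient is
   therefore 0. *)
have u0 X : P X -> gsum (val X :\: val N) * yX X = 0.
  move=> PX; apply/ffunP=> T; rewrite [RHS]ffunE; apply/eqP/negPn/negP => nz.
  have eX := gsum_mul_neq0 (yXin X) nz.
  have NbT : ~~ minor_basis M (val N) (val K) T.
    apply/negP=> /minor_basis_fcl; rewrite eX => eKX; case/and3P: PX => _ /covers_rk.
    by rewrite eKX => /n_Sn.
  have /BmodP/(_ T NbT) : \sum_(X | P X) cover_sum X K * yX X \in Bmod N K.
    by apply: rpred_sum => X' /and3P[_ cX' _]; apply: BmodM (cover_sum_in cX') (yXin X').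
  move/BmodP: xK => /(_ T NbT); rewrite {1}ex' ffunE => + c0; rewrite c0 add0r.
  rewrite ext_sumE (bigD1 X) //= big1 ?addr0 => [|X' /andP[_ neX']].
    by move/eqP; rewrite (negPf nz).
  apply/eqP/negPn/negP => /(gsum_mul_neq0 (yXin X')); rewrite eX => eX'.
  by rewrite eX' eqxx in neX'.
rewrite ex' [X in _ + X]big1 // addr0; apply: in_span_sum => X PX.
case/and3P: (PX) => sNX cXK mX.
have ltX : (rk M (val X) < n)%N by rewrite (covers_rk cXK) in leK.
have := IH X ltX (yX X) sNX (yXin X) (u0 X PX).
apply: (in_span_map (f := *%R (cover_sum X K))) => [v w|_ [s /andP[nbcs /eqP es] ->]].
  exact: mulrBr.
rewrite -es in cXK mX *; have [nbcm eK] := nbc_cons nbcs cXK mK mX min_m.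
apply: in_span_gen; exists (m :: s); first by rewrite nbcm eK eqxx.
by rewrite /= eK.
Qed.

End BrokenCircuits.

(** * The isomorphism *)

Lemma in_spanM (R : pzRingType) (G H T : R -> Prop) x y :
    (forall a b, G a -> H b -> in_span T (a * b)) ->
  in_span G x -> in_span H y -> in_span T (x * y).
Proof.
move=> GHT Gx Hy; apply: (in_span_map (f := *%R^~ y)) Gx => [a b|a Ga]; first exact: mulrBl.
by apply: (in_span_map (f := *%R a)) Hy => [b c|b Hb]; [exact: mulrBr | exact: GHT].
Qed.

(** * Reduction of paths to valleys of nbc flags *)

Section Spanning.
Context {d : Order.disp_t} {E : finOrderType d} (M : matroid E).
Implicit Types (F G K L N X Y : flat M) (s t : seq E) (p q r w : seq (flat M)).

Lemma fpath_nonpath K p : ~~ path (@adjacent E M) K p -> fpath K p = 0.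
Proof. by move=> /negPf NKp; rewrite /fpath insubF. Qed.

Lemma fpathM K p L q :
  fpath K p * fpath L q = if last K p == L then fpath K (p ++ q) else 0 :> path_alg M.
Proof.
have [Kp|NKp] := boolP (path (@adjacent E M) K p); last first.
  by rewrite (fpath_nonpath NKp) mul0r fpath_nonpath ?if_same // cat_path negb_and NKp.
have [Lq|NLq] := boolP (path (@adjacent E M) L q); last first.
  rewrite [fpath L q]fpath_nonpath // mulr0; case: eqP => // eL.
  by rewrite fpath_nonpath // cat_path eL negb_and NLq orbT.
pose u : flag_path M := Sub (K, p) Kp; pose v : flag_path M := Sub (L, q) Lq.
rewrite -[fpath K p]/(fpath (val u).1 (val u).2) -[fpath L q]/(fpath (val v).1 (val v).2).
rewrite !fpathE -[_ * _]/(path_mul << u >> << v >>) path_mulE.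
case: pcatP => [/negPf/= -> //|a eL ea].
by rewrite -fpathE ea; move: eL => /= ->; rewrite eqxx.
Qed.

(** Taking the whole list of flats as one argument fits the realizations in [nbc_flag_span]. The
    empty list is not a path and gets the default 0. *)
Definition flag_elt w : S_alg M :=
  if w is K :: p then qpi (@relator E M) (fpath K p) else 0.

Definition rev_flag_elt w := flag_elt (rev w).

Lemma flag_eltM K p L q :
  flag_elt (K :: p) * flag_elt (L :: q) =
  if last K p == L then flag_elt (K :: p ++ q) else 0.
Proof. by rewrite /= S_algM fpathM; case: ifP => // _; apply: raddf0. Qed.

Arguments flag_elt : simpl never.

Lemma flag_elt_cat w1 K w2 :
  flag_elt (w1 ++ K :: w2) = flag_elt (rcons w1 K) * flag_elt (K :: w2).
Proof.
case: w1 => [|H w1]; first by rewrite flag_eltM eqxx.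
by rewrite rcons_cons flag_eltM last_rcons eqxx cat_rcons.
Qed.

Lemma flag_elt_cons K L p : flag_elt [:: K, L & p] = flag_elt [:: K; L] * flag_elt (L :: p).
Proof. exact: (flag_elt_cat [:: K]). Qed.

Lemma rev_flag_elt_cons K L p :
  rev_flag_elt [:: K, L & p] = rev_flag_elt (L :: p) * flag_elt [:: L; K].
Proof.
by rewrite /rev_flag_elt !rev_cons -[rcons (rcons _ _) _]cats1 cat_rcons flag_elt_cat.
Qed.

Lemma relator_eq0 a : relator a -> qpi (@relator E M) a = 0.
Proof.
move=> Ra; rewrite -[RHS](raddf0 (qpi (@relator E M))).
by apply/qpi_eq; rewrite subr0; apply: in_ideal_gen.
Qed.

Lemma flag_elt_FS q K L p : val L \proper val K -> rk M (val K) = (rk M (val L)).+2 ->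
  \sum_(X : flat M | covers L X && covers X K) flag_elt (q ++ [:: K, X, L & p]) = 0.
Proof.
move=> pLK rK; under eq_bigr => X _.
  rewrite flag_elt_cat (flag_elt_cat [:: K; X]); over.
rewrite -mulr_sumr -mulr_suml; have := relator_eq0 (relator_down pLK rK).
by rewrite raddf_sum /= => ->; rewrite mul0r mulr0.
Qed.

Lemma rev_flag_elt_FS q K L p : val L \proper val K -> rk M (val K) = (rk M (val L)).+2 ->
  \sum_(X : flat M | covers L X && covers X K) rev_flag_elt (q ++ [:: K, X, L & p]) = 0.
Proof.
move=> pLK rK; under eq_bigr => X _.
  rewrite /rev_flag_elt rev_cat !rev_cons -!cats1 -!catA /=.
  rewrite flag_elt_cat (flag_elt_cat [:: L; X]); over.
rewrite -mulr_sumr -mulr_suml; have := relator_eq0 (relator_up pLK rK).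
by rewrite raddf_sum /= => ->; rewrite mul0r mulr0.
Qed.

Definition valley (x : S_alg M) : Prop := exists K p L q,
  [/\ descending K p, descending L q, last K p = last L q &
      x = flag_elt (K :: p) * rev_flag_elt (L :: q)].

Definition nbc_valley (x : S_alg M) : Prop := exists N s t,
  [/\ nbc N s, nbc N t & x = flag_elt (nbc_flag N s) * rev_flag_elt (nbc_flag N t)].

(** The two legs are straightened independently, by [nbc_flag_span] for [flag_elt] and for
    [rev_flag_elt]; both keep the bottom flat. *)
Lemma valley_nbc x : valley x -> in_span nbc_valley x.
Proof.
case=> K [p [L [q [dKp dLq eN ->]]]].
have Kp := nbc_flag_span flag_elt_FS [::] dKp.
have Lq := nbc_flag_span rev_flag_elt_FS [::] dLq.
apply: in_spanM Kp Lq => _ _ [s /andP[nbcs _] ->] [t /andP[nbct _] ->].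
by rewrite -eN in nbct *; apply: in_span_gen; exists (last K p), s, t.
Qed.

Lemma valley_down K L x : covers L K -> in_span valley x ->
  in_span valley (flag_elt [:: K; L] * x).
Proof.
move=> cLK; apply: (in_span_map (f := *%R _)) => [a b|y]; first exact: mulrBr.
case=> K' [p [L' [q [dKp dLq eN ->]]]]; rewrite mulrA flag_eltM /=.
case: eqP => [eL|_]; last by rewrite mul0r; apply: in_span0.
apply: in_span_gen; exists K, (L :: p), L', q; split=> //.
  by rewrite /descending /= cLK eL.
by rewrite /= eL.
Qed.

(** Induction on the descending leg. If it is empty, the new step joins the ascending leg. Otherwise
    the wedge relation rewrites K, L, X as a multiple of [K], as 0, or as minus a down step to the
    intersection followed by an up step that meets the shorter leg. *)
Lemma valley_up K L x : covers K L -> in_span valley x ->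
  in_span valley (flag_elt [:: K; L] * x).
Proof.
move=> cKL; apply: (in_span_map (f := *%R _)) => [a b|y]; first exact: mulrBr.
case=> L' [p [R [r [dLp dRr eN ->]]]]; rewrite mulrA.
have [eL|neL] := eqVneq L L'; last first.
  by rewrite flag_eltM /= (negPf neL) mul0r; apply: in_span0.
rewrite -{}eL in dLp eN *.
elim: p K L cKL dLp eN => [|X p IH] K L cKL /=.
  move=> _ eL; apply: in_span_gen; exists K, [::], R, (rcons r K).
  split; rewrite ?last_rcons //.
    by rewrite /descending rcons_path -[path _ _ _]/(descending R r) dRr -eL.
  have [w ew] : exists w, rev (R :: r) = L :: w.
    by exists (behead (rev (R :: r))); rewrite eL lastI rev_rcons.
  rewrite {2}/rev_flag_elt -rcons_cons rev_rcons ew /rev_flag_elt ew.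
  by rewrite 2!flag_eltM /= eqxx flag_eltM /= !eqxx.
case/andP=> cXL dXp eN; rewrite (flag_elt_cons L) mulrA.
have -> : flag_elt [:: K; L] * flag_elt [:: L; X] = flag_elt [:: K; L; X].
  by rewrite flag_eltM /= eqxx.
have [eKX|neK] := eqVneq K X.
  rewrite -eKX in dXp eN *.
  have -> : flag_elt [:: K; L; K] = flag_elt [:: K] *+ #|val L :\: val K|.
    have := relator_eq0 (relator_same cKL).
    by rewrite raddfB raddfMn => /eqP; rewrite subr_eq0 => /eqP.
  rewrite !mulrnAl flag_eltM /= eqxx; apply/in_spanMn/in_span_gen.
  by exists K, p, R, r; split.
have [cI|NcI] := boolP (covers (flatI K X) K); last first.
  rewrite [flag_elt _](relator_eq0 (relator_nonmodular cKL cXL neK NcI)) !mul0r.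
  exact: in_span0.
have -> : flag_elt [:: K; L; X] = - flag_elt [:: K; flatI K X; X].
  have := relator_eq0 (relator_modular cKL cXL neK cI).
  by rewrite raddfD => /eqP; rewrite addr_eq0 => /eqP.
rewrite !mulNr flag_elt_cons -!mulrA; apply/in_spanN/valley_down => //.
by rewrite mulrA; apply: IH => //; apply: covers_flatI cKL cXL cI.
Qed.

(** A path is built from its last flat, itself a trivial valley, by prepending steps; [valley_up]
    and [valley_down] preserve the span of valleys. *)
Lemma S_alg_span x : in_span nbc_valley x.
Proof.
apply: (in_span_trans valley_nbc); rewrite -[x]qreprK; move: (qrepr x) => {x} a.
rewrite -(freeg_sumE a) raddf_sum; apply: in_span_sum => p _.
have -> : << coeff p a *g p >> = << p >> *~ coeff p a :> path_alg M.
  by rewrite freeg_mulz intz.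
rewrite raddfMz /=; apply: in_spanMz; rewrite -fpathE -[qpi _ _]/(flag_elt (_ :: _)).
case: (val p) (valP p) => K s /=; elim: s K => [|L s IH] K /=.
  by move=> _; apply: in_span_gen; exists K, [::], K, [::]; rewrite flag_eltM /= eqxx.
rewrite flag_elt_cons => /andP[/orP[cKL|cLK] /IH Ls].
  exact: valley_up.
exact: valley_down.
Qed.

Lemma flag_rep_elt K p : flag_rep (flag_elt (K :: p)) = path_op K p.
Proof. by rewrite /flag_elt flag_rep_qpi path_rep_fpath. Qed.

Lemma flag_rep_nbc N s : nbc N s ->
  flag_rep (flag_elt (nbc_flag N s)) = mu (summand N (span_flat N s) (nbc_vec N s)).
Proof.
elim: s => [_|b s IH nbcs]; first by rewrite flag_rep_elt span_flat_nil.
have nbcs' : nbc N s by case/and3P: nbcs.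
rewrite /nbc_flag -/(nbc_flag N s) nbc_flagE flag_elt_cons rmorphM -nbc_flagE.
rewrite [X in _ * X]IH // [X in X * _]flag_rep_elt /= step_vertex.
rewrite (step_op_down (nbc_covers nbcs)) mu_summandM ?nbc_vec_in //.
exact: cover_sum_in (nbc_covers nbcs).
Qed.

Lemma flag_rep_nbc_rev N s : nbc N s ->
  flag_rep (rev_flag_elt (nbc_flag N s)) = kappa (summand N (span_flat N s) (nbc_vec N s)).
Proof.
elim: s => [_|b s IH nbcs].
  by rewrite /rev_flag_elt flag_rep_elt span_flat_nil /= vertex_op_kappa.
have nbcs' : nbc N s by case/and3P: nbcs.
rewrite /nbc_flag -/(nbc_flag N s) nbc_flagE rev_flag_elt_cons rmorphM -nbc_flagE.
rewrite [X in X * _]IH // [X in _ * X]flag_rep_elt /= step_vertex.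
rewrite (step_op_up (nbc_covers nbcs)) kappa_summandM ?nbc_vec_in //.
exact: cover_sum_in (nbc_covers nbcs).
Qed.

End Spanning.

(** * Independence of the nbc valleys, and the image of the representation *)

Section Isomorphism.
Context {d : Order.disp_t} {E : finOrderType d} (M : matroid E).
Implicit Types (F G K L N X Y : flat M) (A B : {set E}) (s t : seq E) (z : Btilde M).
Implicit Types (f g : endz (Btilde M)).

Definition coef_at z N K B f : int := f z (N, K) B.

Fact coef_at_additive z N K B : zmod_morphism (coef_at z N K B).
Proof. by move=> f g; rewrite /coef_at BcompB extBE. Qed.

HB.instance Definition _ z N K B := GRing.isZmodMorphism.Build
  (endz (Btilde M)) int (coef_at z N K B) (coef_at_additive z N K B).

Lemma coef_at_mu_kappa z N0 K0 B0 N K K' u v :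
  u \in Bmod N K -> v \in Bmod N K' ->
  coef_at z N0 K0 B0 (mu (summand N K u) * kappa (summand N K' v)) =
  if K0 == K then (u * kappa (summand N K' v) z (N0, N)) B0 else 0.
Proof.
by move=> uB vB; rewrite /coef_at mu_summandE //; case: ifP => // _; rewrite ffunE.
Qed.

(** Here [kappa] sends the components with lower flat [N0] into B^N_F with F = N0, which is zero
    unless [N] contains [N0]. *)
Lemma coef_nbc_valley0 z N0 K0 B0 N K K' u v : ~~ (val N0 \subset val N) ->
  u \in Bmod N K -> v \in Bmod N K' ->
  coef_at z N0 K0 B0 (mu (summand N K u) * kappa (summand N K' v)) = 0.
Proof.
move=> Nsub uB vB; rewrite coef_at_mu_kappa //; case: eqP => // _.
rewrite (_ : kappa _ z (N0, N) = 0) ?mulr0 ?ffunE //; apply/ffunP=> B.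
by rewrite kappa_summandE // eqxx /minor_basis (negPf Nsub) ffunE.
Qed.

Lemma ext_oneE B : (1 : ext E) B = (B == set0)%:R.
Proof. exact: ffunE. Qed.

(** The lowering operator takes the monomial of [t'] into B^N_N, spanned by 1, with coefficient
    given by [nbc_vec_dual]. The raising operator then yields [nbc_vec N s], read off at [t] by the
    same duality. *)
Lemma coef_nbc_valley N s s' t t' : nbc N s -> nbc N s' -> nbc N t -> nbc N t' ->
  coef_at (summand N (span_flat N t') (mono [set b in t'])) N (span_flat N t) [set b in t]
    (mu (summand N (span_flat N s) (nbc_vec N s)) *
     kappa (summand N (span_flat N s') (nbc_vec N s'))) = ((s == t) && (s' == t'))%:R.
Proof.
move=> ns ns' nt nt'; rewrite coef_at_mu_kappa ?nbc_vec_in //.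
set w := kappa _ _ _; have -> : w = 1 *~ (s' == t')%:R.
  apply/ffunP=> B; rewrite kappa_summandE ?nbc_vec_in // eqxx ext_coefMz ext_oneE /=.
  have [->|neB] := eqVneq B set0; last first.
    rewrite mulr0n mul0rz; case: ifP => // bB; have := rk_minor_basis bB.
    by rewrite -[LHS]addn0 => /addnI/esym/eqP; rewrite cards_eq0 (negPf neB).
  rewrite minor_basis0 eqxx mulr1 summandE eqxx /= intz.
  have [eK|neK] := eqVneq (span_flat N s') (span_flat N t').
    by rewrite minor_proj_id ?mono_in ?nbc_basis // ip_mono nbc_vec_dual.
  by rewrite raddf0; case: (s' =P t') neK => // ->; rewrite eqxx.
rewrite mulrzAr mulr1 ext_coefMz; have [eK|neK] := eqVneq (span_flat N t) _.
  by rewrite nbc_vec_dual // mulrzz -natrM mulnb andbC.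
by case: (s =P t) neK => // ->; rewrite eqxx.
Qed.

(** An nbc sequence is increasing, so its underlying set determines it. Nbc flags can thus be
    indexed by the finite type of subsets. *)
Definition sorted_seq B : seq E := sort <=%O (enum B).

Lemma sorted_seqK N s : nbc N s -> sorted_seq [set b in s] = s.
Proof.
move=> nbcs; have [ss us] : sorted <=%O s /\ uniq s.
  elim: s nbcs => // b s IH nbcs; case/and3P: (nbcs) => /IH[ss us] bs _.
  rewrite /= (path_sortedE le_trans) ss us !andbT; split; last first.
    by apply: contra bs => /mem_span_flat; apply.
  apply/allP => c cs; apply: (nbc_min nbcs).
    by rewrite mem_span_flat // inE cs orbT.
  by apply: nbc_mem_notin cs; case/and3P: nbcs.
rewrite -[RHS](sorted_sort le_trans ss); apply/perm_sortP => //.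
- exact: le_total.
- exact: le_trans.
- exact: le_anti.
by apply: uniq_perm; rewrite ?enum_uniq // => b; rewrite mem_enum inE.
Qed.

Lemma set_sorted_seq B : [set b in sorted_seq B] = B.
Proof. by apply/setP=> b; rewrite inE mem_sort mem_enum. Qed.

Definition nbc_triple (i : flat M * {set E} * {set E}) :=
  nbc i.1.1 (sorted_seq i.1.2) && nbc i.1.1 (sorted_seq i.2).

Definition nbc_triple_elt (i : flat M * {set E} * {set E}) : S_alg M :=
  flag_elt (nbc_flag i.1.1 (sorted_seq i.1.2)) *
  rev_flag_elt (nbc_flag i.1.1 (sorted_seq i.2)).

Lemma S_alg_comb (x : S_alg M) : exists c : flat M * {set E} * {set E} -> int,
  x = \sum_(i | nbc_triple i) nbc_triple_elt i *~ c i.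
Proof.
apply: in_span_comb; apply: in_span_trans (S_alg_span x) => _ [N [s [t [ns nt ->]]]].
apply: in_span_gen; exists (N, [set b in s], [set b in t]).
  by rewrite /nbc_triple /= !(sorted_seqK (N := N)) // ns.
by rewrite /nbc_triple_elt /= !(sorted_seqK (N := N)).
Qed.

(* Applied to the basis of one nbc flag above N0 and read off at that of another,
   only the valleys with bottom N containing N0 contribute, so the coefficients
   vanish by descending induction on the bottom. *)
Lemma flag_rep_inj : injective (@flag_rep d E M).
Proof.
suff inj0 (x : S_alg M) : flag_rep x = 0 -> x = 0.
  by move=> x y /eqP; rewrite -subr_eq0 -raddfB => /eqP/inj0/eqP; rewrite subr_eq0 => /eqP.
have [c ->] := S_alg_comb x => rep0.
suff c0 n i : (#|~: val i.1.1| < n)%N -> nbc_triple i -> c i = 0.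
  by rewrite big1 // => i Pi; rewrite (c0 _ i (ltnSn _)) // mulr0z.
elim: n i => // n IH [[N0 B0] B0'] /= leN0 Pi0.
pose coef : {additive endz (Btilde M) -> int} :=
  coef_at (summand N0 (span_flat N0 (sorted_seq B0')) (mono B0')) N0
    (span_flat N0 (sorted_seq B0)) B0.
have := congr1 coef rep0; rewrite raddf0 !raddf_sum (bigD1 (N0, B0, B0')) //=.
have term i : nbc_triple i -> coef (flag_rep (nbc_triple_elt i *~ c i)) =
    (if i == (N0, B0, B0') then c i else 0).
  case: i => [[N B] B'] Pi; have /andP[/= nB nB'] := Pi.
  rewrite !raddfMz /= rmorphM [X in X * _]flag_rep_nbc // [X in _ * X]flag_rep_nbc_rev //.
  have [sN0|Nsub] := boolP (val N0 \subset val N); last first.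
    rewrite coef_nbc_valley0 ?nbc_vec_in // mul0rz !xpair_eqE.
    by case: (N =P N0) Nsub => // ->; rewrite subxx.
  (* A bottom strictly containing [N0] has a smaller complement, so its coefficient is already known
     to vanish. *)
  have [eN|neN] := eqVneq N N0; last first.
    rewrite !xpair_eqE (negPf neN) /= (IH (N, B, B')) ?mulr0z //=.
    rewrite -ltnS (leq_trans _ leN0) // ltnS proper_card // properC.
    by rewrite properEneq sN0 andbT val_eqE eq_sym.
  case/andP: Pi0 => /= nB0 nB0'; rewrite eN in nB nB' *.
  have := coef_nbc_valley nB nB' nB0 nB0'; rewrite !set_sorted_seq => cv.
  rewrite [X in X *~ _]cv.
  have inj_sorted : injective sorted_seq.
    exact: (can_inj (g := fun s => [set b in s]) set_sorted_seq).
  rewrite !xpair_eqE eqxx /= !(inj_eq inj_sorted).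
  by case: ifP => _; [exact: intz | rewrite mulr0n mul0rz].
rewrite term // eqxx big1 ?addr0 // => i /andP[Pi /negPf nei].
by rewrite term // nei.
Qed.

Lemma in_subring0 : in_subring (@mu_kappa d E M) 0.
Proof. by rewrite -(subrr 1); apply: in_subringB; apply: in_subring1. Qed.

Lemma Ucheck_summand F G x :
  gsum (val G :\: val F) * minor_proj F G x = 0 -> summand F G x \in @Ucheck d E M.
Proof.
move=> ux0; apply/forallP => F'; apply/forallP => G'; apply/implyP => _.
rewrite summandE; case: ifP => [/andP[/eqP-> /eqP->]|_]; last by rewrite mulr0.
by rewrite -/(gsum _) ux0.
Qed.

Lemma Ucheck_cover K L : covers K L -> summand K L (cover_sum K L) \in @Ucheck d E M.
Proof. by move=> cKL; apply: Ucheck_summand; rewrite minor_proj_id ?cover_sum_in ?gsum_sqr. Qed.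

Lemma path_op_in K p : in_subring (@mu_kappa d E M) (path_op K p).
Proof.
elim: p K => [|L p IH] K /=.
  apply: in_subring_gen; exists (summand K K 1); last by left.
  (* The defining condition for 1 at (K, K) is trivial, the sum over K \ K being empty. *)
  by apply: Ucheck_summand; rewrite setDv gsum0 mul0r.
apply: in_subringM (IH L); rewrite /step_op; case: ifP => [cKL|_].
  by apply: in_subring_gen; exists (summand K L (cover_sum K L)); [exact: Ucheck_cover|right].
case: ifP => [cLK|_]; last exact: in_subring0.
by apply: in_subring_gen; exists (summand L K (cover_sum L K)); [exact: Ucheck_cover|left].
Qed.

Lemma flag_rep_in (x : S_alg M) : flag_rep x \in subring_gen (@mu_kappa d E M).
Proof.
have fw w : in_subring (@mu_kappa d E M) (flag_rep (flag_elt w)).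
  case: w => [|K p]; first by rewrite /flag_elt raddf0; apply: in_subring0.
  by rewrite flag_rep_elt; apply: path_op_in.
apply/subring_genP; elim: (S_alg_span x) => [_ [N [s [t [_ _ ->]]]]||y z _ Hy _ Hz].
- by rewrite rmorphM; apply: in_subringM; apply: fw.
- by rewrite raddf0; apply: in_subring0.
- by rewrite raddfB; apply: in_subringB.
Qed.

Definition in_image f : Prop := exists x : S_alg M, flag_rep x = f.

Lemma in_image_span f : in_span in_image f -> in_image f.
Proof.
elim=> [//||g h _ [x <-] _ [y <-]]; first by exists 0; rewrite raddf0.
by exists (x - y); rewrite raddfB.
Qed.

(** Serves for [mu] and [kappa] alike: [u] splits into its summands, and [nbc_vec_span] expands each
    one in nbc products. *)
Lemma Ucheck_span (h : Btilde M -> endz (Btilde M)) u : zmod_morphism h ->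
    (forall N s, nbc N s -> in_image (h (summand N (span_flat N s) (nbc_vec N s)))) ->
  u \in @Ucheck d E M -> in_image (h u).
Proof.
move=> hB h_nbc /forallP Uu; apply: in_image_span.
apply: (in_span_map (G := fun x => exists N s, nbc N s /\
    x = summand N (span_flat N s) (nbc_vec N s))) hB _ _ _ => [_ [N [s [ns ->]]]|].
  by apply: in_span_gen; apply: h_nbc.
rewrite [u]Btilde_sum; apply: in_span_sum => -[F G] _ /=.
have [sFG|NsFG] := boolP (val F \subset val G); last first.
  suff -> : u (F, G) = 0 by rewrite raddf0; apply: in_span0.
  apply/ffunP=> B; have /BmodP := BcompP u F G => ->; first by rewrite ffunE.
  by rewrite /minor_basis (negPf NsFG).
have /forallP/(_ G)/implyP/(_ sFG)/eqP u0 := Uu F.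
apply: (in_span_map (f := summand F G)) (nbc_vec_span sFG (BcompP u F G) u0).
  exact: raddfB.
move=> _ [s /andP[ns /eqP <-] ->]; apply: in_span_gen; by exists F, s.
Qed.

Lemma flag_rep_surj f : f \in subring_gen (@mu_kappa d E M) -> in_image f.
Proof.
move=> /subring_genP; elim=> {f} [_ [u Uu [->|->]]||f g _ [x <-] _ [y <-]|f g _ [x <-] _ [y <-]].
- apply: Ucheck_span Uu => [|N s ns]; first exact: mu_additive.
  by exists (flag_elt (nbc_flag N s)); apply: flag_rep_nbc.
- apply: Ucheck_span Uu => [|N s ns]; first exact: kappa_additive.
  by exists (rev_flag_elt (nbc_flag N s)); apply: flag_rep_nbc_rev.
- by exists 1; rewrite rmorph1.
- by exists (x - y); rewrite raddfB.
- by exists (x * y); rewrite rmorphM.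
Qed.

Definition flag_iso (x : S_alg M) : End_subalg M := Subring (flag_rep_in x).

Fact flag_iso_additive : zmod_morphism flag_iso.
Proof. by move=> x y; apply: val_inj; rewrite raddfB /= raddfB. Qed.

HB.instance Definition _ := GRing.isZmodMorphism.Build (S_alg M) (End_subalg M)
  flag_iso flag_iso_additive.

Fact flag_iso_monoid : monoid_morphism flag_iso.
Proof.
split=> [|x y]; apply: val_inj; first by rewrite rmorph1 /= rmorph1.
by rewrite rmorphM /= rmorphM.
Qed.

HB.instance Definition _ := GRing.isMonoidMorphism.Build (S_alg M) (End_subalg M)
  flag_iso flag_iso_monoid.

End Isomorphism.

Theorem theorem11p2 (d : Order.disp_t) (E : finOrderType d) (M : matroid E) :
  exists phi : {rmorphism S_alg M -> End_subalg M}, bijective phi.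
Proof.
exists (@flag_iso d E M); have inj : injective (@flag_iso d E M).
  move=> x y exy; apply: flag_rep_inj.
  exact: (congr1 (fun f : End_subalg M => subring_val f) exy).
(* Surjectivity gives a preimage of each element; choosing one throughout yields the inverse map. *)
have [f|g gK] := choice (P := fun (f : End_subalg M) (x : S_alg M) => flag_iso x = f).
  by have [x ex] := flag_rep_surj (valP f); exists x; apply: val_inj.
by exists g => // x; apply: inj; rewrite gK.
Qed.
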